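(* Let $\mathbf{M}\subset\mathbb{E}^2$ be an $\mathbf{o}$-symmetric, strictly convex body with $C^\infty$-class boundary. For any $\lambda>0$ and any integer $n\ge 3$, let $A_n(\mathbf{M},\lambda)$ denote the infimum of the $\lambda$-truncated areas of all B-$n$-gons of $\mathbf{M}$. Then, for every $\lambda>0$, the sequence $\{A_n(\mathbf{M},\lambda)\}_{n\ge3}$ is convex (i.e. $A_{n-1}(\mathbf{M},\lambda)+A_{n+1}(\mathbf{M},\lambda)\ge 2A_n(\mathbf{M},\lambda)$ for all $n\ge 4$). Furthermore, if $k$ is a (positive) divisor of $n$ and $\mathbf{M}$ has $k$-fold rotational symmetry, then there is a B-$n$-gon of $\mathbf{M}$ with $k$-fold rotational symmetry whose $\lambda$-truncated area is $A_n(\mathbf{M},\lambda)$. In particular, if $n$ is even, there is an $\mathbf{o}$-symmetric B-$n$-gon of $\mathbf{M}$ whose $\lambda$-truncated area is $A_n(\mathbf{M},\lambda)$.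
   Context: An $\mathbf{o}$-symmetric convex body in the Euclidean plane $\mathbb{E}^2$ is a compact convex set $\mathbf{M}$ with non-empty interior and $\mathbf{M}=-\mathbf{M}$; $\mathbb{M}$ is the normed plane with unit ball $\mathbf{M}$ and norm $\|\mathbf{x}\|_{\mathbb{M}}:=\min\{\mu>0 : \mathbf{x}\in\mu\mathbf{M}\}$ for $\mathbf x\ne\mathbf o$ (and $\|\mathbf o\|_{\mathbb M}=0$). If $\mathbf{x}_1,\dots,\mathbf{x}_k\in\mathbb{M}$ satisfy $\|\mathbf{x}_i\|_{\mathbb{M}}\ge 2$ for all $1\le i\le k$, then the set $$\mathbf{P}=\{\mathbf{x} : \|\mathbf{x}\|_{\mathbb{M}}\le\|\mathbf{x}-\mathbf{x}_i\|_{\mathbb{M}}\text{ for all } 1\le i\le k\}$$ is called a bisector $k$-gon (B-$k$-gon) of $\mathbf{M}$. For $\lambda>0$, the area (Lebesgue measure) of $\mathbf{P}\cap(1+\lambda)\mathbf{M}$ is called the $\lambda$-truncated area of $\mathbf{P}$. A set has $k$-fold rotational symmetry if it is invariant under the Euclidean rotation about $\mathbf{o}$ by angle $2\pi/k$. *)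

(* Defs.v *)
From HB Require Import structures.
From mathcomp Require Import all_boot all_order all_algebra.
From mathcomp Require Import all_classical all_reals all_analysis.

Set Implicit Arguments.
Unset Strict Implicit.
Unset Printing Implicit Defensive.

Import Order.TTheory GRing.Theory Num.Theory.
Import numFieldNormedType.Exports.

Local Open Scope classical_set_scope.
Local Open Scope ring_scope.

(* The plane is [R * R] with its product topology (the Euclidean topology) and
   the product of the one-dimensional Lebesgue measures. *)

Section Plane.
Variable R : realType.
Implicit Types (S M P : set (R * R)).

Definition o_symmetric S : Prop := [set - x | x in S] = S.

Definition convex_body S : Prop :=
  [/\ compact S, convex_set S & S° !=set0].

Definition o_symmetric_convex_body S : Prop :=
  convex_body S /\ o_symmetric S.

Definition strictly_convex S : Prop :=
  forall (x y : R * R) (t : R), S x -> S y -> x != y -> 0 < t < 1 ->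
    S° (t *: x + (1 - t) *: y).

Definition boundary S : set (R * R) := closure S `\` S°.

Definition Cinfty (g : R -> R) : Prop :=
  forall (n : nat) (x : R), derivable (derive1n n g) x 1.

(* The boundary is a one-dimensional C^oo submanifold of the plane: near each
   of its points it is the graph of a C^oo function over one of the two
   coordinate axes. Taking the function to be defined on all of [R] is no
   restriction, as only its germ at a point matters. *)
Definition Cinfty_boundary S : Prop :=
  forall p : R * R, boundary S p ->
    exists g : R -> R, Cinfty g /\
      ((\forall q \near p, boundary S q <-> q.2 = g q.1) \/
       (\forall q \near p, boundary S q <-> q.1 = g q.2)).

Definition dilate (mu : R) S : set (R * R) := [set mu *: x | x in S].

(* When [M] is an o-symmetric convex body and [x != 0] the infimum is a
   minimum. *)
Definition gauge_norm M (x : R * R) : R :=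
  if x == 0 then 0 else inf [set mu : R | 0 < mu /\ dilate mu M x].

(* The points [x i] need not be distinct. *)
Definition Bgon M (k : nat) P : Prop :=
  exists x : 'I_k -> R * R,
    (forall i, 2 <= gauge_norm M (x i)) /\
    P = [set y | forall i, gauge_norm M y <= gauge_norm M (y - x i)].

Definition area S : \bar R :=
  ((@lebesgue_measure R) \x (@lebesgue_measure R))%E S.

Definition truncated_area M (lambda : R) P : \bar R :=
  area (P `&` dilate (1 + lambda) M).

Definition inf_truncated_area M (lambda : R) (n : nat) : \bar R :=
  ereal_inf [set truncated_area M lambda P | P in Bgon M n].

Definition rotation (theta : R) (x : R * R) : R * R :=
  (cos theta * x.1 - sin theta * x.2, sin theta * x.1 + cos theta * x.2).

Definition rotational_symmetry (k : nat) S : Prop :=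
  [set rotation (2 * pi / k%:R) x | x in S] = S.

End Plane.

(* Main.v *)
(* Write [N] for the norm of [M]. Moving the points towards the origin until they
   have norm 2 shrinks the cell, so a B-n-gon may be encoded by a nondecreasing
   sequence [t : int -> R] of directions with [t (i + n) = t i + 2 pi].

   For a point [y], the directions of the vectors [x] of norm 2 with
   [N (y - x) < N y] form, up to full turns, an interval. If [t] and [u] both
   meet an interval, so do [max t u] and [min t u]; hence, for every [y], the
   number of the cells of [max t u] and [min t u] that contain [y] is at most
   the corresponding number for [t] and [u]. Integrating, the truncated area is
   submodular on the lattice of such sequences, without any polar coordinates.

   Minimizers exist by compactness, because bisectors are null sets. They are
   closed under [max], so the maximum of the [k] rotated copies of a minimizer is
   a symmetric minimizer. Convexity in [n] is the same submodularity, applied to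
   a sequence that winds twice and to its translate by half a period. *)

Require Import Defs.
From HB Require Import structures.
From mathcomp Require Import all_boot all_order all_algebra.
From mathcomp Require Import ring lra zify.
From mathcomp Require Import all_classical all_reals all_analysis.
From mathcomp Require Import measurable_realfun.

Import Order.TTheory GRing.Theory Num.Theory.
Import numFieldNormedType.Exports.

Local Open Scope classical_set_scope.
Local Open Scope ring_scope.

Set Implicit Arguments.
Unset Strict Implicit.

(** * Invariance of area under shears, translations and rotations *)

Section PlaneMeasure.
Variable R : realType.

Let plane := (measurableTypeR R * measurableTypeR R)%type.
Notation leb := (@lebesgue_measure R).

Lemma lebesgue_measureD (c : R) (A : set (measurableTypeR R)) : measurable A ->
  leb ((fun x => x + c) @^-1` A) = leb A.
Proof.
have mf : measurable_fun setT ((fun x => x + c) : measurableTypeR R -> measurableTypeR R).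
  exact: measurable_funD.
move=> mA; apply/esym.
rewrite -[RHS]/(pushforward leb ((fun x => x + c) : measurableTypeR R -> measurableTypeR R) A).
apply: lebesgue_measure_unique => //= _ [[a b]] _ <-.
rewrite /pushforward.
have -> : (fun x : R => x + c) @^-1` `]a, b]%classic = `]a - c, b - c]%classic.
  by apply/seteqP; split=> x /=; rewrite !in_itv/= ltrBlDr lerBrDr.
by rewrite !lebesgue_measure_itv/= !lte_fin ltrD2r; case: ifP => // _; congr (_%:E); lra.
Qed.

Lemma measurable_shear2 (f : R -> R) :
  measurable_fun setT (f : measurableTypeR R -> measurableTypeR R) ->
  measurable_fun setT ((fun z => (z.1, z.2 + f z.1)) : plane -> plane).
Proof.
move=> mf; apply: measurable_fun_pair => //=.
by apply: measurable_funD => //; apply: measurableT_comp => //.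
Qed.

Lemma measurable_shear1 (f : R -> R) :
  measurable_fun setT (f : measurableTypeR R -> measurableTypeR R) ->
  measurable_fun setT ((fun z => (z.1 + f z.2, z.2)) : plane -> plane).
Proof.
move=> mf; apply: measurable_fun_pair => //=.
by apply: measurable_funD => //; apply: measurableT_comp => //.
Qed.

(** On each vertical line the shear is a translation, and [area] integrates the lengths of the
    vertical sections. *)
Lemma area_shear2 (f : R -> R) (A : set plane) :
  measurable A ->
  area ((fun z => (z.1, z.2 + f z.1)) @^-1` A) = area A.
Proof.
move=> mA; rewrite /area /product_measure1; apply: eq_integral => x _ /=.
rewrite -(lebesgue_measureD (f x) (measurable_xsection x mA)).
congr (leb _); apply/seteqP; split => y; rewrite /xsection/= !inE.
Qed.

(** Product measures are determined by their values on boxes, so area may also be integrated along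
    horizontal sections, the form suited to horizontal shears. *)
Lemma area_product2E (A : set plane) : measurable A ->
  area A = (leb \x^ leb)%E A.
Proof.
move=> mA; apply: product_measure_unique => // B C mB mC.
by rewrite -product_measure2E.
Qed.

Lemma area_shear1 (f : R -> R) (A : set plane) :
  measurable_fun setT (f : measurableTypeR R -> measurableTypeR R) ->
  measurable A ->
  area ((fun z => (z.1 + f z.2, z.2)) @^-1` A) = area A.
Proof.
move=> mf mA; rewrite !area_product2E//; last first.
  by rewrite -[X in measurable X]setTI; exact: measurable_shear1.
rewrite /product_measure2; apply: eq_integral => y _ /=.
rewrite -(lebesgue_measureD (f y) (measurable_ysection y mA)).
congr (leb _); apply/seteqP; split => x; rewrite /ysection/= !inE.
Qed.

(** An open set is the union of the boxes with rational corners that it contains, and these are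
    countably many. *)
Lemma open_plane_measurable (A : set (R * R)) :
  open A -> measurable (A : set plane).
Proof.
move=> oA.
pose D (q : (rat * rat) * (rat * rat)) : set plane :=
  `]ratr q.1.1, ratr q.1.2[%classic `*` `]ratr q.2.1, ratr q.2.2[%classic.
have -> : A = \bigcup_(q in [set q | D q `<=` A]) D q.
  apply/seteqP; split => [[x y] Axy|p [q /= qA qp]]; last exact: qA.
  have := open_nbhs_nbhs (conj oA Axy); rewrite -nbhs_ballE => -[e /= e0 eA].
  have [a] : exists q : rat, ratr q \in `]x - e, x[ by apply: rat_in_itvoo; rewrite ltrBlDr ltrDl.
  rewrite in_itv/= => /andP[a1 a2].
  have [b] : exists q : rat, ratr q \in `]x, x + e[ by apply: rat_in_itvoo; rewrite ltrDl.
  rewrite in_itv/= => /andP[b1 b2].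
  have [c] : exists q : rat, ratr q \in `]y - e, y[ by apply: rat_in_itvoo; rewrite ltrBlDr ltrDl.
  rewrite in_itv/= => /andP[c1 c2].
  have [d] : exists q : rat, ratr q \in `]y, y + e[ by apply: rat_in_itvoo; rewrite ltrDl.
  rewrite in_itv/= => /andP[d1 d2].
  exists ((a, b), (c, d)) => /=; last first.
    by rewrite /D/=; split; rewrite /= in_itv/=; apply/andP.
  move=> [u v] [/=]; rewrite !in_itv/= => /andP[u1 u2] /andP[v1 v2].
  apply: eA; split; rewrite /ball/= ltr_norml; lra.
rewrite bigcup_mkcond; apply: countable_bigcupT_measurable => // q.
by case: ifP => // _; apply: measurableX; exact: measurable_itv.
Qed.

Lemma closed_plane_measurable (A : set (R * R)) :
  closed A -> measurable (A : set plane).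
Proof.
by move=> /closed_openC/open_plane_measurable/measurableC; rewrite setCK.
Qed.

(** By inclusion-exclusion each sum is the area of the union plus that of the intersection. This
    turns pointwise counting of cells into an inequality of areas. *)
Lemma area_modular (A B C D : set plane) :
  measurable A -> measurable B -> measurable C -> measurable D ->
  (area C < +oo)%E -> (area D < +oo)%E ->
  A `&` B `<=` C `&` D -> A `|` B `<=` C `|` D ->
  (area A + area B <= area C + area D)%E.
Proof.
have UI (X Y : set plane) : measurable X -> measurable Y ->
    (area X + area Y = area (X `|` Y) + area (X `&` Y))%E.
  move=> mX mY.
  have E1 : area (X `|` Y) = (area X + area (Y `\` X))%E.
    have -> : X `|` Y = X `|` (Y `\` X).
      by apply/seteqP; split => z /=; case: (pselect (X z)); tauto.
    rewrite /area measureU//; first exact: measurableD.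
    by rewrite setDE setICA setICr setI0.
  have E2 : area Y = (area (Y `\` X) + area (X `&` Y))%E.
    transitivity (area ((Y `\` X) `|` (X `&` Y))).
      by congr area; apply/seteqP; split => z /=; case: (pselect (X z)); tauto.
    rewrite /area measureU//.
    - exact: measurableD.
    - exact: measurableI.
    - by apply/seteqP; split => z //= [[_ +] []].
  by rewrite E1 {1}E2 addeA.
move=> mA mB mC mD fC fD sI sU; rewrite (UI A B)// (UI C D)//; apply: leeD.
  by apply: le_measure => //; rewrite inE; exact: measurableU.
by apply: le_measure => //; rewrite inE; exact: measurableI.
Qed.

Lemma area_bounded_lty (A : set (R * R)) (r : R) : measurable (A : set plane) ->
  (forall z, A z -> `|z| <= r) -> (area A < +oo)%E.
Proof.
move=> mA Ar; pose I := `[- r, r]%classic : set (measurableTypeR R).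
have mI : measurable I by exact: measurable_itv.
apply: (@le_lt_trans _ _ (area (I `*` I))).
  apply: le_measure; rewrite ?inE//; first exact: measurableX.
  move=> [x y] /Ar; rewrite /Num.norm/= ge_max !ler_norml => /andP[rx ry].
  by split; rewrite /I/= in_itv.
rewrite /area product_measure1E// /I/= !lebesgue_measure_itv/=.
by case: ifP => _; rewrite ?mule0// -EFinB -EFinM ltry.
Qed.

Lemma measurable_preimage (f : plane -> plane) (A : set plane) :
  measurable_fun setT f -> measurable A -> measurable (f @^-1` A).
Proof. by move=> mf mA; rewrite -[X in measurable X]setTI; exact: mf. Qed.

Lemma area_translation (v : R * R) (A : set plane) : measurable A ->
  area ((fun z => z + v) @^-1` A) = area A.
Proof.
move=> mA; rewrite (_ : _ @^-1` A =
  (fun z : plane => (z.1, z.2 + cst v.2 z.1)) @^-1`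
   ((fun z : plane => (z.1 + cst v.1 z.2, z.2)) @^-1` A))//.
rewrite area_shear2; first exact: area_shear1.
by apply: measurable_preimage => //; exact: measurable_shear1.
Qed.

Lemma rotationD (a b : R) (z : R * R) :
  rotation (a + b) z = rotation a (rotation b z).
Proof. by rewrite /rotation/= cosD sinD; congr pair; ring. Qed.

(* A rotation by an angle [t] with [cos (t / 2) != 0] is a product of three
   shears, and every rotation is a fourth power of such a rotation. *)
Let rotation_shears (t : R) : cos (t / 2) != 0 ->
  rotation t = (fun z => (z.1 + (- tan (t / 2)) * z.2, z.2)) \o
    (fun z => (z.1, z.2 + sin t * z.1)) \o
    (fun z => (z.1 + (- tan (t / 2)) * z.2, z.2)).
Proof.
move=> c0; have tE : t = t / 2 + t / 2 by field.
have cs := cos2Dsin2 (t / 2).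
have [cE sE] : cos t = cos (t / 2) ^+ 2 - sin (t / 2) ^+ 2 /\
    sin t = 2 * sin (t / 2) * cos (t / 2).
  by split; rewrite {1}tE ?cosD ?sinD; ring.
apply/funext => -[x y]; rewrite /rotation/= cE sE /tan.
move: c0 cs; set a := cos _; set b := sin _ => c0 cs.
have aE : a ^+ 2 = 1 - b ^+ 2 by rewrite -cs; ring.
have bE : b ^+ 2 = 1 - a ^+ 2 by rewrite -cs; ring.
congr pair.
  transitivity ((1 - 2 * b ^+ 2) * x - (2 * b / a) * (1 - b ^+ 2) * y); last by field.
  by rewrite -aE {1}aE; field.
transitivity (2 * b * a * x + (1 - 2 * b ^+ 2) * y); last by field.
by rewrite aE; ring.
Qed.

Lemma area_rotation_shears (t : R) (A : set plane) : cos (t / 2) != 0 ->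
  measurable A -> measurable (rotation t @^-1` A : set plane) /\
  area (rotation t @^-1` A) = area A.
Proof.
move=> c0 mA; rewrite rotation_shears// !comp_preimage.
have ml (c : R) : measurable_fun setT
    ((fun x => c * x) : measurableTypeR R -> measurableTypeR R).
  exact: measurable_funM.
have m1 := measurable_preimage (measurable_shear1 (ml (- tan (t / 2)))) mA.
have m2 := measurable_preimage (measurable_shear2 (ml (sin t))) m1.
have m3 := measurable_preimage (measurable_shear1 (ml (- tan (t / 2)))) m2.
split; first exact: m3.
by rewrite (area_shear1 (ml _))// (area_shear2 _ m1) (area_shear1 (ml _)).
Qed.

Lemma area_rotation (t : R) (A : set plane) : 0 <= t <= 2 * pi ->
  measurable A -> area (rotation t @^-1` A) = area A.
Proof.
move=> /andP[t0 t2] mA; set s := t / 4.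
(* A quarter of the angle puts [s / 2] in [[0, pi / 4]], where the cosine is positive. *)
have c0 : cos (s / 2) != 0.
  rewrite gt_eqF// cos_gt0_pihalf//; have := pi_gt0 R; rewrite /s => pi0.
  by apply/andP; split; lra.
have -> : rotation t = rotation s \o rotation s \o (rotation s \o rotation s).
  apply/funext => z /=; rewrite -!rotationD; congr rotation.
  by rewrite /s; field.
rewrite !comp_preimage.
have [m1 a1] := area_rotation_shears c0 mA.
have [m2 a2] := area_rotation_shears c0 m1.
have [m3 a3] := area_rotation_shears c0 m2.
have [m4 a4] := area_rotation_shears c0 m3.
by rewrite a4 a3 a2 a1.
Qed.

End PlaneMeasure.

(** Cells and windings are studied through these properties alone. The two comparisons with the sup
    norm supply continuity, definiteness and compactness; the last field is strict convexity of the
    balls. *)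
Record is_plane_norm (R : realType) (N : R * R -> R) : Prop := IsPlaneNorm {
  plane_normD : forall x y, N (x + y) <= N x + N y;
  plane_normZ : forall a x, N (a *: x) = `|a| * N x;
  plane_norm_le : exists2 C, 0 < C & forall x, N x <= C * `|x|;
  plane_norm_ge : exists2 C, 0 < C & forall x, `|x| <= C * N x;
  plane_norm_strict : forall x y a t, N x <= a -> N y <= a -> x != y ->
    0 < t < 1 -> N (t *: x + (1 - t) *: y) < a }.

(** * The gauge of a strictly convex body as a strictly convex norm *)

Section Gauge.
Variable R : realType.
Variable M : set (R * R).
Hypothesis M_body : o_symmetric_convex_body M.

Let N := gauge_norm M.

Let M_conv (x y : R * R) (t : R) : M x -> M y -> 0 <= t <= 1 ->
  M (t *: x + (1 - t) *: y).
Proof.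
move=> Mx My /andP[t0 t1]; case: M_body => -[_ cM _] _.
by have := cM x y (Itv01 t0 t1); rewrite !inE; apply.
Qed.

Let M_opp (x : R * R) : M x -> M (- x).
Proof. by case: M_body => _ E Mx; rewrite -E; exists x. Qed.

Let M_ball : exists2 e, 0 < e & forall z : R * R, `|z| < e -> M z.
Proof.
case: M_body => -[_ _ [p]] /nbhs_ballP[e /= e0 eM] _.
exists (e / 2) => [|z ze]; first by rewrite divr_gt0.
have Mp : M p by apply: eM; exact: ballxx.
have Mq : M (p + 2 *: z).
  apply: eM; rewrite -ball_normE /ball_/= opprD addrA subrr add0r normrN.
  by rewrite prod_norm_scale gtr0_norm// -ltr_pdivlMl// mulrC.
(* Here [z] is the midpoint of [p + 2 *: z], which is close to [p], and of [- p], which is in [M] by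
   symmetry. *)
have -> : z = 2^-1 *: (p + 2 *: z) + (1 - 2^-1) *: (- p).
  have -> : 1 - 2^-1 = 2^-1 :> R by field.
  by rewrite -scalerDr addrAC subrr add0r scalerA mulVf// scale1r.
apply: M_conv => //; first exact: M_opp.
by apply/andP; split; lra.
Qed.

Let M0 : M 0.
Proof. by have [e e0] := M_ball; apply; rewrite normr0. Qed.

Let M_shrink (x : R * R) (s : R) : 0 <= s <= 1 -> M x -> M (s *: x).
Proof.
move=> s01 Mx; have -> : s *: x = s *: x + (1 - s) *: 0 by rewrite scaler0 addr0.
exact: M_conv.
Qed.

Let M_closed : closed M.
Proof.
by case: M_body => -[+ _ _ _]; apply: compact_closed; exact: norm_hausdorff.
Qed.

Let M_bounded : exists2 B, 0 < B & forall x, M x -> `|x| <= B.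
Proof.
case: M_body => -[/compact_bounded + _ _] _.
move=> /ex_strict_bound_gt0[B /= B0 MB]; exists B => // x Mx; apply/ltW.
exact: MB.
Qed.

Let dilateE (mu : R) (x : R * R) : 0 < mu -> dilate mu M x = M (mu^-1 *: x).
Proof.
move=> mu0; apply/propext; split => [[y My <-]|Mx].
  by rewrite scalerA mulVf ?gt_eqF// scale1r.
by exists (mu^-1 *: x) => //=; rewrite scalerA mulfV ?gt_eqF// scale1r.
Qed.

Let gauges (x : R * R) := [set mu : R | 0 < mu /\ dilate mu M x].

Let gauge_lb (B : R) : 0 < B -> (forall x, M x -> `|x| <= B) ->
  forall x, lbound (gauges x) (B^-1 * `|x|).
Proof.
move=> B0 MB x mu [mu0]; rewrite dilateE// => /MB.
rewrite prod_norm_scale gtr0_norm ?invr_gt0// ler_pdivrMl// => h.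
by rewrite ler_pdivrMl// mulrC.
Qed.

(** The infimum is attained: [M] is star-shaped about the origin, so it contains [s *: x] for all
    [0 <= s < r^-1], and closedness adds the endpoint. *)
Lemma gauge_norm_leP (x : R * R) (r : R) : 0 < r -> (N x <= r) <-> M (r^-1 *: x).
Proof.
move=> r0; rewrite /N /gauge_norm; case: eqVneq => [->|x0].
  by rewrite scaler0; split => // _; exact: ltW.
have [B B0 MB] := M_bounded.
split=> [Nr|Mx]; last first.
  apply: ge_inf; first by exists (B^-1 * `|x|); exact: gauge_lb.
  by split => //; rewrite dilateE.
have ne : gauges x !=set0.
  have [e e0 eM] := M_ball; exists (2 * `|x| / e); split.
    by rewrite divr_gt0// mulr_gt0// normr_gt0.
  rewrite dilateE ?divr_gt0// ?mulr_gt0// ?normr_gt0//; apply: eM.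
  have nx : 0 < `|x| by rewrite normr_gt0.
  rewrite prod_norm_scale gtr0_norm; last by rewrite invr_gt0 divr_gt0// mulr_gt0.
  rewrite [ltLHS](_ : _ = e / 2); first lra.
  by field; rewrite !gt_eqF.
have Ms s : 0 <= s < r^-1 -> M (s *: x).
  move=> /andP[s0 sr]; have [->|sn0] := eqVneq s 0; first by rewrite scale0r.
  have sp : 0 < s by rewrite lt_neqAle eq_sym sn0.
  have : inf (gauges x) < s^-1.
    by apply: le_lt_trans Nr _; rewrite -[ltLHS]invrK ltf_pV2 ?posrE ?invr_gt0.
  move=> /inf_lt -/(_ ne)[mu [mu0]]; rewrite dilateE// => Mmu mus.
  have -> : s *: x = (s * mu) *: (mu^-1 *: x).
    by rewrite scalerA mulfK// gt_eqF.
  apply: M_shrink => //; apply/andP; split; first by rewrite mulr_ge0// ltW.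
  by rewrite -ler_pdivlMl// mulr1 ltW.
have [//|nM] := pselect (M (r^-1 *: x)).
have oC : open (~` M) by apply: closed_openC.
have := open_nbhs_nbhs (conj oC nM).
move=> /nbhs_ballP[e /= e0 eM].
(* The point [(r^-1 - d) *: x] is then within [e] of [r^-1 *: x], hence outside [M], although its
   factor lies in [[0, r^-1)]. *)
pose d := Num.min (r^-1 / 2) (e / (2 * `|x|)).
have nx : 0 < `|x| by rewrite normr_gt0.
have ri : 0 < r^-1 by rewrite invr_gt0.
have d0 : 0 < d by rewrite lt_min !divr_gt0// mulr_gt0.
have d1 : d <= r^-1 / 2 by rewrite ge_min lexx.
have d2 : d <= e / (2 * `|x|) by rewrite ge_min lexx orbT.
exfalso; apply: (eM ((r^-1 - d) *: x)); last by apply: Ms; apply/andP; split; lra.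
rewrite -ball_normE /ball_/= -scalerBl opprB addrCA subrr addr0.
rewrite prod_norm_scale gtr0_norm//.
move: d2; rewrite ler_pdivlMr ?mulr_gt0// => d2.
have : 0 < d * `|x| by rewrite mulr_gt0.
lra.
Qed.

Lemma dilate_gauge_norm (r : R) : 0 < r -> dilate r M = [set x | N x <= r].
Proof.
move=> r0; apply/seteqP; split => x /=.
  by rewrite dilateE// => Mx; apply/gauge_norm_leP.
by move=> /(gauge_norm_leP _ r0) Mx; rewrite dilateE.
Qed.

Let N0 : N 0 = 0. Proof. by rewrite /N /gauge_norm eqxx. Qed.

Let N_ge : exists2 C, 0 < C & forall x, `|x| <= C * N x.
Proof.
have [B B0 MB] := M_bounded; exists B => // x.
have [->|x0] := eqVneq x 0; first by rewrite N0 normr0 mulr0.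
rewrite -ler_pdivrMl// /N /gauge_norm (negbTE x0); apply: lb_le_inf.
  have [e e0 eM] := M_ball.
  have nx : 0 < `|x| by rewrite normr_gt0.
  exists (2 * `|x| / e); split; first by rewrite divr_gt0// mulr_gt0.
  rewrite dilateE ?divr_gt0// ?mulr_gt0//; apply: eM.
  rewrite prod_norm_scale gtr0_norm; last by rewrite invr_gt0 divr_gt0// mulr_gt0.
  rewrite [ltLHS](_ : _ = e / 2); first lra.
  by field; rewrite !gt_eqF.
exact: gauge_lb.
Qed.

Let N_gt0 (x : R * R) : x != 0 -> 0 < N x.
Proof.
have [C C0 CN] := N_ge; rewrite -normr_gt0 => x0.
by rewrite -(pmulr_rgt0 _ C0); exact: lt_le_trans (CN x).
Qed.

Let N_ge0 (x : R * R) : 0 <= N x.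
Proof. by have [->|/N_gt0/ltW//] := eqVneq x 0; rewrite N0. Qed.

Let NZ_le (a : R) (x : R * R) : N (a *: x) <= `|a| * N x.
Proof.
have [->|a0] := eqVneq a 0; first by rewrite scale0r N0 normr0 mul0r.
have [->|x0] := eqVneq x 0; first by rewrite scaler0 N0 mulr0.
have Nx := N_gt0 x0; have an : 0 < `|a| by rewrite normr_gt0.
apply/gauge_norm_leP; first exact: mulr_gt0.
have /(gauge_norm_leP _ Nx) Mx : N x <= N x by [].
rewrite scalerA invfM mulrAC -scalerA.
have [a_pos|a_neg] := ltP 0 a.
  by rewrite gtr0_norm// mulVf// scale1r.
rewrite ler0_norm// invrN mulNr mulVf// scaleN1r; exact: M_opp.
Qed.

Lemma gauge_is_plane_norm : strictly_convex M -> is_plane_norm N.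
Proof.
move=> M_strict.
have NZ (a : R) (x : R * R) : N (a *: x) = `|a| * N x.
  apply/eqP; rewrite eq_le NZ_le/=.
  have [->|a0] := eqVneq a 0; first by rewrite scale0r N0 normr0 mul0r.
  rewrite -ler_pdivlMl ?normr_gt0// -normfV.
  by rewrite -{1}[x](scalerK a0) NZ_le.
split => //.
- move=> x y.
  have [->|x0] := eqVneq x 0; first by rewrite N0 !add0r.
  have [->|y0] := eqVneq y 0; first by rewrite N0 !addr0.
  have Nx := N_gt0 x0; have Ny := N_gt0 y0.
  apply/gauge_norm_leP; first exact: addr_gt0.
  have /(gauge_norm_leP _ Nx) Mx : N x <= N x by [].
  have /(gauge_norm_leP _ Ny) My : N y <= N y by [].
  have Nxy : 0 < N x + N y by exact: addr_gt0.
  (* With weights proportional to the norms, the normalized vectors combine to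
     [(x + y) / (N x + N y)]. *)
  have := @M_conv _ _ (N x / (N x + N y)) Mx My _.
  rewrite (_ : 1 - _ = N y / (N x + N y)); last by field; rewrite gt_eqF.
  rewrite !scalerA (_ : _ / _ / _ = (N x + N y)^-1); last by field; rewrite !gt_eqF.
  rewrite (_ : _ / _ / _ = (N x + N y)^-1); last by field; rewrite !gt_eqF.
  rewrite -scalerDr; apply; apply/andP; split; first by rewrite divr_ge0// ltW.
  by rewrite ler_pdivrMr// mul1r lerDl ltW.
- have [e e0 eM] := M_ball; exists (2 / e) => [|x]; first by rewrite divr_gt0.
  have [->|x0] := eqVneq x 0; first by rewrite N0 normr0 mulr0.
  have nx : 0 < `|x| by rewrite normr_gt0.
  have p0 : 0 < 2 / e * `|x| by rewrite mulr_gt0// divr_gt0.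
  apply/gauge_norm_leP => //; apply: eM.
  rewrite prod_norm_scale gtr0_norm ?invr_gt0//.
  rewrite [ltLHS](_ : _ = e / 2); first lra.
  by field; rewrite !gt_eqF.
- move=> x y a t Nx Ny xy t01.
  have a0 : 0 < a.
    rewrite lt_neqAle (le_trans (N_ge0 x) Nx) andbT eq_sym.
    apply: contra xy => /eqP a0; rewrite a0 in Nx Ny.
    have [C C0 CN] := N_ge.
    have z0 z : N z <= 0 -> z = 0.
      move=> Nz; apply/eqP; rewrite -normr_le0; apply: le_trans (CN z) _.
      by rewrite pmulr_rle0.
    by rewrite (z0 _ Nx) (z0 _ Ny).
  have /(gauge_norm_leP _ a0) Mx := Nx.
  have /(gauge_norm_leP _ a0) My := Ny.
  have xy' : a^-1 *: x != a^-1 *: y.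
    by apply: contra xy => /eqP/(scalerI (lt0r_neq0 _)) ->//; rewrite invr_gt0.
  have := M_strict _ _ _ Mx My xy' t01.
  rewrite !scalerA [t * _]mulrC [_ * a^-1]mulrC -!scalerA -scalerDr.
  set z := t *: x + _ => /nbhs_ballP[e /= e0 eM].
  have [->|z0] := eqVneq z 0; first by rewrite N0.
  have nz : 0 < `|z| by rewrite normr_gt0.
  (* Scaling by [1 + d] moves [a^-1 *: z] by [e / 2], within [M]; so [(1 + d) * N z <= a], which
     makes [N z < a]. *)
  pose d := e * a / (2 * `|z|).
  have d0 : 0 < d by rewrite /d divr_gt0// mulr_gt0.
  have /eM Md : ball (a^-1 *: z) e (a^-1 *: ((1 + d) *: z)).
    rewrite -ball_normE /ball_/= -scalerBr prod_norm_scale.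
    rewrite scalerDl scale1r opprD addrA subrr add0r normrN prod_norm_scale.
    rewrite !gtr0_norm ?invr_gt0//.
    rewrite [ltLHS](_ : _ = e / 2); first lra.
    by rewrite /d; field; rewrite !gt_eqF.
  have := (gauge_norm_leP _ a0).2 Md.
  rewrite NZ gtr0_norm ?addr_gt0// mulrDl mul1r.
  by have := mulr_gt0 d0 (N_gt0 z0); lra.
Qed.

End Gauge.

(** * Cells, null bisectors and existence of minimizers *)

Section Cells.
Variable R : realType.
Variable N : R * R -> R.
Hypothesis NP : is_plane_norm N.

Let plane := (measurableTypeR R * measurableTypeR R)%type.

Let scale_pairE (a : R) (x : R * R) : a *: x = (a * x.1, a * x.2).
Proof. by []. Qed.

Lemma plane_norm0 : N 0 = 0.
Proof. by rewrite -(scale0r 0) (plane_normZ NP) normr0 mul0r. Qed.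

Lemma plane_normN (x : R * R) : N (- x) = N x.
Proof. by rewrite -scaleN1r (plane_normZ NP) normrN normr1 mul1r. Qed.

Lemma plane_norm_ge0 (x : R * R) : 0 <= N x.
Proof.
have [C C0 CN] := plane_norm_ge NP.
by rewrite -(pmulr_rge0 _ C0); apply: le_trans (CN x).
Qed.

Lemma plane_norm_gt0 (x : R * R) : x != 0 -> 0 < N x.
Proof.
have [C C0 CN] := plane_norm_ge NP; rewrite -normr_gt0 => x0.
by rewrite -(pmulr_rgt0 _ C0); exact: lt_le_trans (CN x).
Qed.

Lemma plane_norm_dist (x y : R * R) : `|N x - N y| <= N (x - y).
Proof.
have := plane_normD NP (x - y) y; rewrite subrK => h1.
have := plane_normD NP (y - x) x; rewrite subrK => h2.
by rewrite -opprB plane_normN in h2; rewrite ler_norml; apply/andP; split; lra.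
Qed.

Lemma plane_norm_continuous : continuous N.
Proof.
have [C C0 NC] := plane_norm_le NP.
move=> x; apply/cvgrPdist_lt => /= e e0; near=> y.
apply: le_lt_trans (plane_norm_dist x y) _; apply: le_lt_trans (NC _) _.
rewrite -ltr_pdivlMl//; near: y.
by apply: cvgr_dist_lt; rewrite // mulr_gt0// invr_gt0.
Unshelve. all: by end_near. Qed.

Let normB_continuous (x : R * R) : continuous (fun y : R * R => N (y - x)).
Proof.
move=> y; apply: (@continuous_comp _ _ _ (fun y : R * R => y - x) N); last exact: plane_norm_continuous.
by apply: cvgB; [exact: cvg_id|exact: cvg_cst].
Qed.

(** Indexing by a set of points makes the cell of a finite family and that of an infinite periodic
    sequence equal as soon as their ranges agree. *)
Definition cell (X : set (R * R)) : set (R * R) :=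
  [set y | forall x, X x -> N y <= N (y - x)].

Definition disk (r : R) : set (R * R) := [set y | N y <= r].

Lemma disk_closed (r : R) : closed (disk r).
Proof.
apply: (@preimage_closed _ _ N [set x | x <= r]); last exact: closed_le.
by move=> x _; exact: plane_norm_continuous.
Qed.

Let gap_closed (x : R * R) (c : R) : closed [set y | N y + c <= N (y - x)].
Proof.
have -> : [set y | N y + c <= N (y - x)] =
    (fun y => N (y - x) - N y) @^-1` [set s | c <= s].
  by apply/seteqP; split => y /=; rewrite lerBrDl.
apply: preimage_closed; last exact: closed_ge.
move=> y _; apply: cvgB; first exact: normB_continuous.
exact: plane_norm_continuous.
Qed.

Lemma cell_closed (X : set (R * R)) : closed (cell X).
Proof.
have -> : cell X = \bigcap_(x in X) [set y | N y + 0 <= N (y - x)].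
  by apply/seteqP; split => y /= h x Xx; have := h x Xx => /=; rewrite addr0.
by apply: closed_bigI => x _; exact: gap_closed.
Qed.

Lemma cell_disk_measurable (X : set (R * R)) (r : R) :
  measurable (cell X `&` disk r : set plane).
Proof.
apply: closed_plane_measurable; apply: closedI; first exact: cell_closed.
exact: disk_closed.
Qed.

Lemma disk_subset_lty (A : set plane) (r : R) :
  measurable A -> A `<=` disk r -> (area A < +oo)%E.
Proof.
move=> mA Ar; have [C C0 CN] := plane_norm_ge NP.
apply: (@area_bounded_lty _ _ (C * r)) => // z /Ar Nz.
by apply: le_trans (CN z) _; rewrite ler_pM2l.
Qed.

(** Suppose both points are on the bisector. Then [y + s *: x - x] is strictly between [y - x] and
    [y], which have equal norm, so [N (y + s *: x) < N y]. But [y] is strictly between [y - x] and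
    [y + s *: x], both of norm at most [N y], so [N y < N y]. *)
Let bisector_translate (x y : R * R) (s : R) : x != 0 -> 0 < s < 1 ->
  N y = N (y - x) -> N (y + s *: x) <> N (y + s *: x - x).
Proof.
move=> x0 /andP[s0 s1] yx E.
have xy : y - x != y by rewrite -subr_eq0 addrAC subrr add0r oppr_eq0.
have h1 : N (y + s *: x) < N y.
  rewrite E (_ : _ - x = (1 - s) *: (y - x) + (1 - (1 - s)) *: y).
    apply: (plane_norm_strict NP) => //; first by rewrite -yx.
    by apply/andP; split; lra.
  by case: (y) (x) => y1 y2 [x1 x2]; rewrite !scale_pairE; congr pair => /=; ring.
have xs : y - x != y + s *: x.
  rewrite -subr_eq0 opprD addrACA subrr add0r -opprD oppr_eq0.
  by rewrite -{1}(scale1r x) -scalerDl scaler_eq0 negb_or x0 andbT gt_eqF ?addr_gt0.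
have h2 : N (s / (1 + s) *: (y - x) + (1 - s / (1 + s)) *: (y + s *: x)) < N y.
  apply: (plane_norm_strict NP) => //; first by rewrite yx.
    exact: ltW.
  by rewrite divr_gt0 ?addr_gt0//= ltr_pdivrMr ?addr_gt0// mul1r ltrDr.
move: h2; rewrite [X in N X](_ : _ = y) ?ltxx//.
have s10 : 1 + s != 0 by rewrite gt_eqF// addr_gt0.
by case: (y) (x) => y1 y2 [x1 x2]; rewrite !scale_pairE; congr pair => /=; field.
Qed.

Let bisector_closed (x : R * R) (r : R) :
  closed ([set y | N y = N (y - x)] `&` disk r).
Proof.
apply: closedI; last exact: disk_closed.
have -> : [set y | N y = N (y - x)] =
    (fun y => N (y - x) - N y) @^-1` [set z | z = 0].
  by apply/seteqP; split => y /= => [->|/eqP]; rewrite ?subrr// subr_eq0 => /eqP.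
apply: preimage_closed; last exact: closed_eq.
move=> y _; apply: cvgB; first exact: normB_continuous.
exact: plane_norm_continuous.
Qed.

Let bisector_measurable (x : R * R) (r : R) :
  measurable ([set y | N y = N (y - x)] `&` disk r : set plane).
Proof. by apply: closed_plane_measurable; exact: bisector_closed. Qed.

(* The points [y] and [y + s *: x] with [0 < s < 1] cannot both lie on the
   bisector of [0] and [x], by strict convexity along the line through them.
   Hence the translates of the bisector by [s *: x] are disjoint. *)
Lemma area_bisector (x : R * R) (r : R) : x != 0 ->
  area ([set y | N y = N (y - x)] `&` disk r) = 0%E.
Proof.
move=> x0; set E := _ `&` _.
have cE : closed E by exact: bisector_closed.
have mE : measurable (E : set plane) by exact: closed_plane_measurable.
(* Infinitely many distinct shifts in the open unit interval, so that any two differ by less than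
   1. *)
pose s (k : nat) : R := k.+2%:R^-1.
have s0 k : 0 < s k by rewrite invr_gt0.
have s1 k : s k < 1 by rewrite invf_lt1// ltr1n.
pose F k := (fun z => z + (- (s k *: x))) @^-1` E : set plane.
have mF k : measurable (F k).
  apply: closed_plane_measurable; apply: preimage_closed => //.
  by move=> y _; apply: cvgD; [exact: cvg_id|exact: cvg_cst].
have aF k : area (F k) = area E by exact: area_translation.
have dF i j z : s i < s j -> F i z -> F j z -> False.
  move=> ij [/= Fi _] [/= Fj _].
  apply: (@bisector_translate x (z - s j *: x) (s j - s i)) => //.
    by rewrite subr_gt0 ij/=; have := s0 i; have := s1 j; lra.
  rewrite (_ : z - s j *: x + _ = z - s i *: x)//.
  by case: (z) (x) => z1 z2 [x1 x2]; rewrite !scale_pairE; congr pair => /=; ring.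
have tF : trivIset setT F.
  move=> i j _ _ [z [Fi Fj]].
  have [/(dF _ _ _)/(_ Fi Fj)//|/(dF _ _ _)/(_ Fj Fi)//|/invr_inj/eqP] := ltgtP (s i) (s j).
  by rewrite eqr_nat => /eqP[].
have FK k : F k `<=` disk (r + N x).
  move=> z [_ Nz]; rewrite /disk/= -(subrK (s k *: x) z).
  apply: le_trans (plane_normD NP _ _) _; apply: lerD => //.
  rewrite (plane_normZ NP) gtr0_norm//.
  by apply: ler_piMl; [exact: plane_norm_ge0|exact: ltW].
have mD : measurable (disk (r + N x) : set plane).
  by apply: closed_plane_measurable; exact: disk_closed.
have fD := disk_subset_lty mD (@subset_refl _ _).
have fE : (area E < +oo)%E.
  by apply: (disk_subset_lty mE (r := r)) => z [].
have E0 : (0 <= area E)%E by exact: measure_ge0.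
apply/eqP; rewrite eq_le E0 andbT leNgt; apply/negP => En0.
have [a aE] : exists a, area E = a%:E.
  by exists (fine (area E)); rewrite fineK// ge0_fin_numE.
have [b bE] : exists b, area (disk (r + N x)) = b%:E.
  by exists (fine (area (disk (r + N x)))); rewrite fineK// ge0_fin_numE// measure_ge0.
have a0 : 0 < a by rewrite -lte_fin -aE.
(* The first [n] translates are disjoint subsets of a disk of finite area [b]; a large [n] gives the
   contradiction. *)
have le n : a *+ n <= b.
  have nE : (a *+ n)%:E = area (\big[setU/set0]_(i < n) F i).
    rewrite /area measure_bigsetU//.
    by rewrite (eq_bigr (fun=> a%:E)) => [|i _]; rewrite ?sumEFin ?sumr_const ?card_ord// -aE -(aF i).
  rewrite -lee_fin nE -bE; apply: le_measure; rewrite ?inE//.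
    exact: bigsetU_measurable.
  by rewrite -bigcup_mkord => z [i _]; exact: FK.
have := le (Num.bound (b / a)).
rewrite leNgt => /negP; apply.
rewrite -mulr_natr mulrC -ltr_pdivrMr//.
apply: archi_boundP; apply: divr_ge0; last exact: ltW.
by rewrite -lee_fin -bE measure_ge0.
Qed.

(* The convex function [s |-> N (y - s *: x)] has value [N y] at [0], so once it
   is at least [N y] it stays so. *)
Lemma cell_shrink (I : Type) (w : I -> R * R) : (forall i, 2 <= N (w i)) ->
  cell (range (fun i => (2 / N (w i)) *: w i)) `<=` cell (range w).
Proof.
move=> w2 y yc _ [i _ <-]; have := yc _ (imageT _ i); set s := 2 / _ => h.
have Nw : 0 < N (w i) by exact: lt_le_trans (w2 i).
have s0 : 0 < s by rewrite divr_gt0.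
have s1 : s <= 1 by rewrite ler_pdivrMr// mul1r.
have E : y - s *: w i = s *: (y - w i) + (1 - s) *: y.
  by case: (y) (w i) => y1 y2 [x1 x2]; rewrite !scale_pairE; congr pair => /=; ring.
have := plane_normD NP (s *: (y - w i)) ((1 - s) *: y).
rewrite -E !(plane_normZ NP) (ger0_norm (ltW s0)) ger0_norm ?subr_ge0// => h2.
by rewrite -(ler_pM2l s0); lra.
Qed.

Let sphere : set (R * R) := [set x | N x = 2].

Let sphere_compact : compact sphere.
Proof.
have [C C0 CN] := plane_norm_ge NP.
pose I := `[- (C * 2), C * 2]%classic : set R.
apply: (@subclosed_compact _ _ (I `*` I)).
- apply: (@preimage_closed _ _ N [set x | x = 2]); last exact: closed_eq.
  by move=> x _; exact: plane_norm_continuous.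
- by apply: compact_setX; exact: segment_compact.
- move=> [x y] Nx; have := CN (x, y).
  rewrite Nx /Num.norm/= ge_max !ler_norml => /andP[rx ry].
  by split; rewrite /I/= in_itv.
Qed.

Let sphere_nonempty : sphere !=set0.
Proof.
have u0 : ((1, 0) : R * R) != 0 by apply/eqP => -[] /eqP; rewrite oner_eq0.
have Nu := plane_norm_gt0 u0.
exists ((2 / N (1, 0)) *: (1, 0)); rewrite /sphere/= (plane_normZ NP).
by rewrite gtr0_norm ?divr_gt0// divfK// gt_eqF.
Qed.

(* The area is lower semicontinuous in [v]: the cell of any [v'] within
   [1 / (j + 1)] of [v] contains the set [Q j] below, and the [Q j] exhaust the
   cell of [v] up to bisectors, which are null sets. *)
Lemma area_cell_min (n : nat) (r : R) :
  exists v : 'I_n -> R * R,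
  (forall i, N (v i) = 2) /\ forall w : 'I_n -> R * R, (forall i, 2 <= N (w i)) ->
  (area (cell (range v) `&` disk r) <= area (cell (range w) `&` disk r))%E.
Proof.
pose T := prod_topology (fun _ : 'I_n => (R * R)%type).
pose X : set T := [set v | forall i, sphere (v i)].
have cX : compact X.
  exact: (@tychonoff 'I_n (fun=> (R * R)%type) (fun=> sphere) (fun=> sphere_compact)).
pose a (v : T) := area (cell (range v) `&` disk r).
have mC Y := cell_disk_measurable Y r.
have a_lty v : (a v < +oo)%E.
  by apply: (disk_subset_lty (mC _) (r := r)) => z [].
pose m := ereal_inf (a @` X).
have m0 : (0 <= m)%E.
  by apply: le_ereal_inf_tmp => _ [v _ <-]; exact: measure_ge0.
have mfin : m \is a fin_num.
  have [u Su] := sphere_nonempty.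
  rewrite ge0_fin_numE//; apply: le_lt_trans (a_lty (fun=> u)).
  by apply: ereal_inf_lbound; exists (fun=> u).
(* A minimizing sequence; [w] below is a cluster point of it, which exists by Tychonoff's
   theorem. *)
have [v vX] : {v : nat -> T & forall k, X (v k) /\ (a (v k) < m + (k.+1%:R^-1)%:E)%E}.
  apply: (@choice _ _ (fun k w => X w /\ (a w < m + (k.+1%:R^-1)%:E)%E)) => k.
  have [|_ [w Xw <-] aw] := @lb_ereal_inf_adherent _ _ (k.+1%:R^-1) _ mfin.
    by rewrite invr_gt0.
  by exists w.
have [w [Xw clw]] : exists w, (X `&` cluster (v @ \oo)) w.
  by apply: cX; exists 0%N => // k _; exact: (vX k).1.
pose Q j : set plane := [set y | forall i, N y + j.+1%:R^-1 <= N (y - w i)] `&` disk r.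
have mQ j : measurable (Q j).
  apply: closed_plane_measurable; apply: closedI; last exact: disk_closed.
  rewrite (_ : [set y | _] = \bigcap_i [set y | N y + j.+1%:R^-1 <= N (y - w i)]).
    by apply: closed_bigI => i _; exact: gap_closed.
  by apply/seteqP; split => y /= h i => [_|]; exact: h.
have Qm j : (area (Q j) <= m)%E.
  (* Some [v k] with [k] beyond [k0] is within [1 / (j + 1)] of [w] in every coordinate, so its cell
     contains [Q j]; its area exceeds [m] by less than [e]. *)
  apply/lee_addgt0Pr => e e0.
  have [k0 k0e] : exists k0 : nat, k0.+1%:R^-1 < e.
    have [k0 _ h] := near_infty_natSinv_lt (PosNum e0).
    by exists k0; apply: h => /=.
  have Bw : nbhs (w : T) [set u : T | forall i, N (w i - u i) < j.+1%:R^-1].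
    apply: (@filter_forall T _ (fun i (u : T) => N (w i - u i) < j.+1%:R^-1) (nbhs w)).
    move=> i; have := @proj_continuous 'I_n (fun=> (R * R)%type) i w
      [set x | N (w i - x) < j.+1%:R^-1]; apply.
    have [C C0 NC] := plane_norm_le NP.
    have d0 : 0 < C^-1 * j.+1%:R^-1 by rewrite mulr_gt0 ?invr_gt0.
    apply: filterS (nbhsx_ballx (w i) _ d0) => u; rewrite -ball_normE /= => wu.
    by apply: le_lt_trans (NC _) _; rewrite -ltr_pdivlMl.
  have [||_ [[k /= kk0 <-] Bk]] := clw [set v k | k in [set k | (k0 <= k)%N]]
    [set u : T | forall i, N (w i - u i) < j.+1%:R^-1].
  - by exists k0 => // k kk0; exists k.
  - exact: Bw.
  apply: (@le_trans _ _ (a (v k))).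
    apply: le_measure; rewrite ?inE//.
    move=> y [/= yQ yr]; split => // _ [i _ <-].
    have h1 : N y + j.+1%:R^-1 <= N (y - w i) := yQ i.
    have h2 : N (v k i - w i) < j.+1%:R^-1 by rewrite -opprB plane_normN; exact: Bk.
    have := plane_normD NP (y - v k i) (v k i - w i).
    rewrite addrA subrK => h3.
    rewrite -(lerD2r j.+1%:R^-1); apply: le_trans h1 _; apply: le_trans h3 _.
    by rewrite lerD2l ltW.
  apply: le_trans (ltW (vX k).2) _; apply: leeD => //; rewrite lee_fin.
  apply: le_trans (ltW k0e); rewrite lef_pV2 ?posrE// ler_nat; lia.
have Um : (area (\bigcup_j Q j) <= m)%E.
  have mU : measurable (\bigcup_j Q j) by exact: bigcupT_measurable.
  apply: (cvge_le _ (@nondecreasing_cvg_mu _ _ _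
    (@lebesgue_measure R \x @lebesgue_measure R)%E _ mQ mU _)).
    by near=> j; exact: Qm.
  move=> j k jk; apply/subsetPset => y [/= yQ yr]; split => //= i.
  apply: le_trans (yQ i); rewrite lerD2l lef_pV2 ?posrE// ler_nat; lia.
(* The bisectors are indexed by [nat], with [B k] empty from [n] on, so that countable unions of
   null sets apply. *)
pose B k : set plane :=
  [set y | exists i : 'I_n, i = k :> nat /\ N y = N (y - w i)] `&` disk r.
have w0 i : w i != 0.
  apply/eqP => wi; have := Xw i; rewrite /sphere/= wi plane_norm0 => /eqP.
  by rewrite eq_sym (_ : 2 == 0 = false)// pnatr_eq0.
have BE k : B k = set0 \/ exists i, B k = [set y | N y = N (y - w i)] `&` disk r.
  have [kn|nk] := ltnP k n; [right; exists (Ordinal kn)|left].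
    apply/seteqP; split => y [/= yB yr]; split => //=; last by exists (Ordinal kn).
    by case: yB => i [ik ->]; congr (N (y - w _)); exact: val_inj.
  by apply/seteqP; split => y // [[/= i [ik _]] _]; have := ltn_ord i; lia.
have nB k : (@lebesgue_measure R \x @lebesgue_measure R)%E.-negligible (B k).
  have [->|[i ->]] := BE k; first exact: negligible_set0.
  apply/negligibleP; last exact: (area_bisector r (w0 i)).
  exact: (bisector_measurable (w i) r).
have nUB := negligible_bigcup nB.
have mUB : measurable (\bigcup_k B k).
  apply: bigcupT_measurable => k; have [->//|[i ->]] := BE k.
  exact: (bisector_measurable (w i) r).
have aw : (a w <= m)%E.
  apply: (@le_trans _ _ (area ((\bigcup_j Q j) `|` \bigcup_k B k))).
    apply: le_measure; rewrite ?inE//.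
      by apply: measurableU => //; exact: bigcupT_measurable.
    move=> y [yc yr].
    have [[i yi]|yn] := pselect (exists i, N y = N (y - w i)).
      by right; exists i => //; split => //; exists i.
    left; have [j yj] : exists j : nat, forall i, N y + j.+1%:R^-1 <= N (y - w i).
      apply: (@filter_ex _ \oo).
      apply: (@filter_forall _ _ (fun i j => N y + j.+1%:R^-1 <= N (y - w i)) \oo) => i.
      have yi : 0 < N (y - w i) - N y.
        rewrite subr_gt0 lt_neqAle yc//; first by rewrite andbT; apply/eqP => E; apply: yn; exists i.
      apply: filterS (near_infty_natSinv_lt (PosNum yi)) => j /=.
      by rewrite ltrBrDl => /ltW.
    by exists j.
  apply: le_trans (measureU2 _ _ _) _ => //; first exact: bigcupT_measurable.
  by rewrite (measure_negligible mUB nUB) adde0.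
exists w; split => // u u2; apply: (le_trans aw).
(* A competitor with norms at least 2 is first pulled back to the sphere, which shrinks its cell. *)
apply: (@le_trans _ _ (a (fun i => (2 / N (u i)) *: u i))).
  apply: ereal_inf_lbound; exists (fun i => (2 / N (u i)) *: u i) => // i.
  rewrite /sphere/= (plane_normZ NP) gtr0_norm.
    by rewrite divfK// gt_eqF// (lt_le_trans _ (u2 i)).
  by rewrite divr_gt0// (lt_le_trans _ (u2 i)).
apply: le_measure; rewrite ?inE//.
by move=> y [yc yr]; split => //; exact: cell_shrink yc.
Unshelve. all: by end_near. Qed.

End Cells.

(** * Directions, full turns and rotations *)

Section Angles.
Variable R : realType.

Definition circle (a : R) : R * R := (cos a, sin a).

Definition turn (k : int) : R := 2 * pi * k%:~R.

Lemma turnD (j k : int) : turn (j + k) = turn j + turn k.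
Proof. by rewrite /turn intrD mulrDr. Qed.

Lemma turnN (k : int) : turn (- k) = - turn k.
Proof. by rewrite /turn intrN mulrN. Qed.

Lemma circle_turn (a : R) (k : int) : circle (a + turn k) = circle a.
Proof.
have pos (n : nat) b : circle (b + turn n%:Z) = circle b.
  have -> : turn n%:Z = pi *+ 2 *+ n by rewrite /turn mulr_natr mulr_natl.
  by rewrite /circle (periodicn (@cosD2pi R)) (periodicn (@sinD2pi R)).
case: k => n; first exact: pos.
by rewrite NegzE -(pos n.+1) -addrA -turnD addNr /turn mulr0 addr0.
Qed.

Lemma circle_neq0 (a : R) : circle a != 0.
Proof.
apply/eqP => -[c s]; have := cos2Dsin2 a; rewrite c s expr0n/= addr0 => /eqP.
by rewrite eq_sym oner_eq0.
Qed.

Lemma turn_reduce (a b : R) : exists k : int, b <= a + turn k < b + 2 * pi.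
Proof.
have p0 : 0 < 2 * pi :> R by rewrite mulr_gt0// pi_gt0.
pose f := Num.floor ((a - b) / (2 * pi)); exists (- f).
have /andP[] := floor_itv ((a - b) / (2 * pi)); rewrite -/f turnN /turn.
rewrite ler_pdivlMr// intrD ltr_pdivrMr// mulrDl mul1r mulrC => h1 h2.
by apply/andP; split; lra.
Qed.

Lemma polar (x : R * R) : x != 0 ->
  exists a rho, 0 < rho /\ x = rho *: circle a.
Proof.
case: x => x y xy0; pose q := x ^+ 2 + y ^+ 2.
have q0 : 0 < q.
  rewrite lt_neqAle addr_ge0 ?sqr_ge0// andbT eq_sym.
  rewrite paddr_eq0 ?sqr_ge0// !sqrf_eq0.
  by apply: contra xy0 => /andP[/eqP-> /eqP->].
pose rho := Num.sqrt q; have rho0 : 0 < rho by rewrite sqrtr_gt0.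
have rE : rho ^+ 2 = q by rewrite sqr_sqrtr// ltW.
have cE : (x / rho) ^+ 2 + (y / rho) ^+ 2 = 1.
  by rewrite !expr_div_n rE -mulrDl divff// gt_eqF.
have c1 : -1 <= x / rho <= 1.
  have := sqr_ge0 (y / rho); set u := x / rho in cE *; set v := y / rho in cE *.
  by move=> v0; apply/andP; split; nra.
have sE : sin (acos (x / rho)) = `|y / rho|.
  by rewrite sin_acos// -cE addrAC subrr add0r sqrtr_sqr.
have xE : x = rho * (x / rho) by rewrite mulrC divfK// gt_eqF.
have yE : y = rho * (y / rho) by rewrite mulrC divfK// gt_eqF.
have [y0|y0] := leP 0 (y / rho).
  exists (acos (x / rho)), rho; split => //.
  by rewrite /circle acosK ?in_itv// sE ger0_norm// {1}xE {1}yE.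
exists (- acos (x / rho)), rho; split => //.
by rewrite /circle cosN sinN acosK ?in_itv// sE ltr0_norm// opprK {1}xE {1}yE.
Qed.

(** Cramer's rule gives the coefficients as quotients of sines; all angles involved lie in
    [[0, pi)], so these are nonnegative. *)
Lemma circle_cone (a b c : R) : a <= b <= c -> c < a + pi ->
  exists s t, [/\ 0 <= s, 0 <= t & circle b = s *: circle a + t *: circle c].
Proof.
move=> /andP[ab bc] ca.
have [ac|ac] := eqVneq a c.
  have -> : b = a by apply/eqP; rewrite eq_le ab andbT ac.
  by exists 1, 0; rewrite scale1r scale0r addr0.
have lac : a < c by rewrite lt_neqAle ac (le_trans ab).
have s0 : 0 < sin (c - a) by apply: sin_gt0_pi; apply/andP; split; lra.
exists (sin (c - b) / sin (c - a)), (sin (b - a) / sin (c - a)); split.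
- by apply: divr_ge0 (ltW s0); apply: sin_ge0_pi; apply/andP; split; lra.
- by apply: divr_ge0 (ltW s0); apply: sin_ge0_pi; apply/andP; split; lra.
have sn0 : sin (c - a) != 0 by rewrite gt_eqF.
have pairE (u : R) (x : R * R) : u *: x = (u * x.1, u * x.2) by [].
have Ec : sin (c - a) * cos b = sin (c - b) * cos a + sin (b - a) * cos c.
  rewrite !sinB; move: (sin a) (cos a) (sin b) (cos b) (sin c) (cos c) => *; ring.
have Es : sin (c - a) * sin b = sin (c - b) * sin a + sin (b - a) * sin c.
  rewrite !sinB; move: (sin a) (cos a) (sin b) (cos b) (sin c) (cos c) => *; ring.
move: Ec Es; rewrite !pairE /circle/=.
set S := sin (c - a) in s0 sn0 *; set U := sin (c - b); set V := sin (b - a).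
move=> Ec Es; congr pair; apply: (mulfI sn0).
  by rewrite /= Ec; field.
by rewrite /= Es; field.
Qed.

Lemma rotation_circle (a b : R) : rotation a (circle b) = circle (a + b).
Proof. by rewrite /rotation/circle/= cosD sinD; congr pair; ring. Qed.

Lemma rotationB (a : R) (x y : R * R) :
  rotation a (x - y) = rotation a x - rotation a y.
Proof. by rewrite /rotation; congr pair => /=; ring. Qed.

Lemma rotationZ (a c : R) (x : R * R) :
  rotation a (c *: x) = c *: rotation a x.
Proof.
have pairE (u : R) (z : R * R) : u *: z = (u * z.1, u * z.2) by [].
by rewrite !pairE /rotation; congr pair => /=; ring.
Qed.

Lemma rotation0 : rotation 0 = (id : R * R -> R * R).
Proof.
by apply/funext => -[x y]; rewrite /rotation cos0 sin0/=; congr pair; ring.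
Qed.

Lemma rotationNK (a : R) : cancel (rotation (- a)) (rotation a : R * R -> R * R).
Proof. by move=> x; rewrite -rotationD subrr rotation0. Qed.

Lemma rotationK (a : R) : cancel (rotation a) (rotation (- a) : R * R -> R * R).
Proof. by move=> x; rewrite -rotationD addNr rotation0. Qed.

End Angles.

(** * The directions whose vertices cut off a given point *)

Section Arcs.
Variable R : realType.
Variable N : R * R -> R.
Hypothesis NP : is_plane_norm N.

(* If [1 <= s + t], the segment from [0] to [a] crosses the one from [y] to [b],
   and the triangle inequality on both sides of the crossing point yields
   [N (y - a) <= N (y - b)]. Otherwise [a] lies in the triangle [0 y b]. *)
Lemma cone_cut (y a b : R * R) (s t : R) : 0 <= s -> 0 <= t ->
  a = s *: y + t *: b -> N a = N b -> N (y - b) < N y -> 0 < N b ->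
  N (y - a) < N y.
Proof.
move=> s0 t0 aE ab yb b0.
have [st|st] := leP 1 (s + t).
  have st0 : 0 < s + t by apply: lt_le_trans st.
  (* The crossing point is [u *: a = (s * u) *: y + (t * u) *: b]. *)
  pose u := (s + t)^-1.
  have u0 : 0 < u by rewrite invr_gt0.
  have u1 : u <= 1 by rewrite invf_le1.
  have stu : s * u + t * u = 1 by rewrite -mulrDl mulfV// gt_eqF.
  have h1 := plane_normD NP (y - u *: a) (- ((1 - u) *: a)).
  have h2 := plane_normD NP (b - u *: a) (u *: a).
  rewrite subrK in h2.
  have e1 : y - u *: a = (t * u) *: (y - b).
    rewrite aE scalerDr !scalerA -{1}(scale1r y) -stu scalerDl scalerBr.
    by rewrite (mulrC u) (mulrC u) opprD addrACA subrr add0r.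
  have e2 : b - u *: a = - ((s * u) *: (y - b)).
    rewrite aE scalerDr !scalerA -{1}(scale1r b) -stu scalerDl scalerBr.
    by rewrite (mulrC u) (mulrC u) opprD addrACA subrr addr0 opprB.
  have e3 : y - u *: a - (1 - u) *: a = y - a.
    by rewrite scalerBl scale1r opprB addrA subrK.
  rewrite e3 e1 (plane_normN NP) !(plane_normZ NP) in h1.
  rewrite e2 (plane_normN NP) !(plane_normZ NP) in h2.
  have tu : 0 <= t * u by rewrite mulr_ge0// ltW.
  have su : 0 <= s * u by rewrite mulr_ge0// ltW.
  have u1' : 0 <= 1 - u by rewrite subr_ge0.
  rewrite (ger0_norm tu) (ger0_norm u1') in h1.
  rewrite (ger0_norm su) (gtr0_norm u0) ab in h2.
  rewrite ab in h1; apply: le_lt_trans yb.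
  have -> : N (y - b) = (s * u + t * u) * N (y - b) by rewrite stu mul1r.
  clear - h1 h2; rewrite mulrBl mul1r in h1; rewrite mulrDl.
  move: (s * u * _) (t * u * _) (u * _) h1 h2 => A B C h1 h2; lra.
have e : y - a = (1 - (s + t)) *: y + t *: (y - b).
  rewrite aE scalerBl scale1r scalerDl scalerBr opprD -!addrA; congr (y + _).
  by rewrite opprD -addrA; congr (_ + _); rewrite addrA addNr add0r.
have := plane_normD NP ((1 - (s + t)) *: y) (t *: (y - b)).
have st' : 0 <= 1 - (s + t) by rewrite subr_ge0 ltW.
rewrite -e !(plane_normZ NP) (ger0_norm st') (ger0_norm t0) => h.
apply: le_lt_trans h _; rewrite mulrBl mul1r -addrA gtrDl addrC subr_lt0 mulrDl.
have Ny : 0 < N y by apply: le_lt_trans yb; exact: plane_norm_ge0.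
(* Strictness comes from [N (y - b) < N y] when [t > 0]. When [t = 0], it comes from [s > 0], since
   [a] is not the origin. *)
have [t00|tn0] := eqVneq t 0; last first.
  apply: ltr_wpDl; first by rewrite mulr_ge0// ltW.
  by rewrite ltr_pM2l// lt_neqAle eq_sym tn0.
rewrite t00 !mul0r addr0 mulr_gt0// lt_neqAle s0 andbT eq_sym.
apply/eqP => s00; move: ab b0; rewrite aE t00 s00 !scale0r addr0 (plane_norm0 NP).
by move=> <-; rewrite ltxx.
Qed.

Definition vertex (a : R) : R * R := (2 / N (circle a)) *: circle a.

Lemma norm_vertex (a : R) : N (vertex a) = 2.
Proof.
have n0 := plane_norm_gt0 NP (circle_neq0 a).
by rewrite (plane_normZ NP) gtr0_norm ?divr_gt0// divfK// gt_eqF.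
Qed.

Lemma vertex_turn (a : R) (k : int) : vertex (a + turn R k) = vertex a.
Proof. by rewrite /vertex circle_turn. Qed.

Lemma vertex_surj (x : R * R) : N x = 2 -> exists a, 0 <= a < 2 * pi /\ x = vertex a.
Proof.
move=> Nx; have x0 : x != 0.
  apply/eqP => x0; move: Nx; rewrite x0 (plane_norm0 NP) => /eqP.
  by rewrite eq_sym (_ : 2 == 0 = false)// pnatr_eq0.
have [a [rho [rho0 xE]]] := polar x0.
have [k] := turn_reduce a 0; rewrite add0r => ak.
exists (a + turn R k); split => //; rewrite vertex_turn /vertex xE.
have n0 := plane_norm_gt0 NP (circle_neq0 a).
by congr (_ *: _); rewrite -Nx xE (plane_normZ NP) gtr0_norm// mulfK// gt_eqF.
Qed.

(** Let [b] be the direction of [y]. By [cone_cut], if a direction cuts off [y], so does every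
    direction between it and [b]. The direction opposite to [b] never does, so the window from
    [b - pi] to [b + pi] represents all cutting directions. *)
Lemma cut_arc (y : R * R) : exists2 I : set R, is_interval I &
  forall a, N (y - vertex a) < N y <-> exists k, I (a + turn R k).
Proof.
have [->|y0] := eqVneq y 0.
  exists set0 => // a; split=> [|[k []]//].
  by rewrite (plane_norm0 NP) ltNge (plane_norm_ge0 NP).
have [b [rho [rho0 yE]]] := polar y0.
pose I := [set a | b - pi < a < b + pi /\ N (y - vertex a) < N y].
have nv c := plane_norm_gt0 NP (circle_neq0 c).
have cut a c s t : 0 <= s -> 0 <= t -> circle a = s *: circle b + t *: circle c ->
    N (y - vertex c) < N y -> N (y - vertex a) < N y.
  move=> s0 t0 aE yc; set k := 2 / N (circle a).
  have k0 : 0 <= k by rewrite divr_ge0// ltW.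
  have [r0 n0] := (ltW rho0, ltW (nv c)).
  (* These coefficients rewrite the combination of unit vectors in terms of [y = rho *: circle b]
     and of the rescaled [vertex c]. *)
  apply: (@cone_cut y (vertex a) (vertex c) (k * s / rho) (k * t * N (circle c) / 2)).
  - by rewrite divr_ge0// mulr_ge0.
  - by rewrite divr_ge0// mulr_ge0// mulr_ge0.
  - rewrite yE !scalerA divfK ?gt_eqF// /vertex -/k aE scalerDr !scalerA.
    by congr (_ + _ *: _); field; rewrite gt_eqF.
  - by rewrite !norm_vertex.
  - exact: yc.
  - by rewrite norm_vertex.
exists I.
- move=> a c [/andP[a1 a2] ya] [/andP[c1 c2] yc] d /andP[ad dc]; split.
    by apply/andP; split; lra.
  have [bd|db] := leP b d.
    have [||s [t [s0 t0 E]]] := @circle_cone R b d c; [by rewrite bd| lra|].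
    exact: cut E yc.
  have [||s [t [s0 t0 E]]] := @circle_cone R a d b; [by rewrite ad ltW| lra|].
  by rewrite addrC in E; exact: cut E ya.
- move=> a; split=> [ya|[k [_]]]; last by rewrite vertex_turn.
  have [k /andP[k1 k2]] := turn_reduce a (b - pi).
  exists k; split; last by rewrite vertex_turn.
  apply/andP; split; last by lra.
  (* At [b - pi] the vertex is a negative multiple of [y], and subtracting it only lengthens [y]. *)
  rewrite lt_neqAle k1 andbT; apply/eqP => E.
  move: ya; rewrite -(vertex_turn a k) -E.
  have -> : vertex (b - pi) = - ((2 / N (circle b) / rho) *: y).
    rewrite /vertex; have -> : circle (b - pi) = - circle b.
      by rewrite /circle cosB sinB cospi sinpi; congr pair => /=; ring.
    by rewrite (plane_normN NP) yE !scalerA divfK ?gt_eqF// scalerN.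
  rewrite opprK -{1}(scale1r y) -scalerDl (plane_normZ NP) gtr0_norm.
    rewrite mulrDl mul1r ltNge lerDl mulr_ge0// ?(plane_norm_ge0 NP)//.
    by rewrite !divr_ge0// ltW.
  by rewrite addr_gt0// !divr_gt0.
Qed.

End Arcs.

(** * Lattice operations and splicing for winding sequences *)

Section Sequences.
Variable R : realType.
Implicit Types (t u v x y z : int -> R) (I : set R).

Definition nondec t := forall i j : int, i <= j -> t i <= t j.

(** Integer indices leave no distinguished first term, so translations are shifts of the index. The
    increment [L] is free because [splice] also uses sequences that wind twice. *)
Definition winds (n : nat) (L : R) t := forall i : int, t (i + n%:Z) = t i + L.

Definition hits I t := exists i, I (t i).

Lemma windsM n L t (i k : int) : winds n L t -> t (i + n%:Z * k) = t i + L * k%:~R.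
Proof.
move=> tn; have pos (m : nat) j : t (j + n%:Z * m%:Z) = t j + L * m%:R.
  elim: m => [|m IH]; first by rewrite !mulr0 !addr0.
  rewrite (_ : j + _ = j + n%:Z * m%:Z + n%:Z); last by rewrite intS; ring.
  by rewrite tn IH -natr1; ring.
case: k => m; first exact: pos.
have := pos m.+1 (i + n%:Z * Negz m).
by rewrite NegzE mulrN subrK => ->; rewrite rmorphN/= mulrN addrK.
Qed.

Lemma nondec_max x y : nondec x -> nondec y -> nondec (fun i => Num.max (x i) (y i)).
Proof.
move=> hx hy i j ij; rewrite ge_max !le_max hx//=.
by rewrite (hy _ _ ij) orbT.
Qed.

Lemma nondec_min x y : nondec x -> nondec y -> nondec (fun i => Num.min (x i) (y i)).
Proof.
move=> hx hy i j ij; rewrite le_min !ge_min hx//=.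
by rewrite (hy _ _ ij) orbT.
Qed.

Lemma winds_max n L x y : winds n L x -> winds n L y ->
  winds n L (fun i => Num.max (x i) (y i)).
Proof. by move=> hx hy i; rewrite hx hy addr_maxl. Qed.

Lemma winds_min n L x y : winds n L x -> winds n L y ->
  winds n L (fun i => Num.min (x i) (y i)).
Proof. by move=> hx hy i; rewrite hx hy addr_minl. Qed.

(** Say [x i] and [y j] are in [I] with [i <= j]. Depending on the order of [x] and [y] at [i] and
    at [j], a suitable term of the maximum or minimum is [x i] or [y j] itself, or is trapped
    between them by monotonicity. *)
Lemma hits_maxmin I x y : is_interval I -> nondec x -> nondec y ->
  hits I x -> hits I y ->
  hits I (fun i => Num.max (x i) (y i)) /\ hits I (fun i => Num.min (x i) (y i)).
Proof.
move=> II.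
suff H x' y' i j : nondec x' -> nondec y' -> i <= j -> I (x' i) -> I (y' j) ->
    hits I (fun i => Num.max (x' i) (y' i)) /\ hits I (fun i => Num.min (x' i) (y' i)).
  move=> nx ny [i xi] [j yj]; have [ij|/ltW ji] := leP i j; first exact: (H _ _ i j).
  have [[k]] := H y x j i ny nx ji yj xi; rewrite maxC => mk [l]; rewrite minC => ml.
  by split; [exists k|exists l].
move=> nx ny ij xi yj.
have [xyi|yxi] := leP (x' i) (y' i).
  split; last by exists i; rewrite min_l.
  have [xyj|yxj] := leP (x' j) (y' j); first by exists j; rewrite max_r.
  exists i; rewrite max_r//; apply: II xi yj _ _.
  by rewrite xyi ny.
have [xyj|yxj] := leP (x' j) (y' j).
  split; first by exists j; rewrite max_r.
  exists j; rewrite min_l//; apply: II xi yj _ _.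
  by rewrite xyj nx.
split; first by exists i; rewrite max_l// ltW.
by exists j; rewrite min_r// ltW.
Qed.

(** Without a crossing, [u] shifted to start below [v] would stay below it forever. But in
    [n * (n + 2)] steps [u] gains [(n + 2) * L] and [v] only [n * L]. *)
Lemma crossing (n : nat) (L : R) u v : (0 < n)%N -> 0 < L ->
  nondec u -> nondec v -> winds n L u -> winds n.+2 L v ->
  exists i j : int, [/\ u i <= v j & v (j + 1) <= u (i + 1)].
Proof.
move=> n0 L0 nu nv un vn.
(* The shift [a = n * q] below satisfies [u a <= v 0 < u a + L]. *)
pose q := Num.floor ((v 0 - u 0) / L).
have /andP[] := floor_itv ((v 0 - u 0) / L); rewrite -/q ler_pdivlMr// intrD ltr_pdivrMr//.
rewrite mulrDl mul1r => q1 q2.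
have uE : u (n%:Z * q) = u 0 + L * q%:~R by rewrite -(windsM _ _ un) add0r.
pose a := n%:Z * q.
apply: contrapT => H.
have ind (m : nat) : u (a + m%:Z) <= v m%:Z.
  elim: m => [|m IH]; first by rewrite addr0 uE mulrC; lra.
  rewrite leNgt; apply/negP => lt; apply: H; exists (a + m%:Z), m%:Z; split => //.
  rewrite (_ : m%:Z + 1 = m.+1%:Z); last lia.
  by rewrite (_ : a + m%:Z + 1 = a + m.+1%:Z) ?ltW//; lia.
have := ind (n * n.+2)%N.
have vE : v (n%:Z * n.+2%:Z) = v 0 + L * n%:Z%:~R.
  by rewrite mulrC -(windsM _ _ vn) add0r.
rewrite PoszM (windsM _ _ un) uE vE -addn2 PoszD intrD mulrDr mulrC.
by move: (L * _) => c; lra.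
Qed.

Lemma int_euclid (d : nat) (p : int) : (0 < d)%N ->
  exists r q, (r < d)%N /\ p = r%:Z + d%:Z * q.
Proof.
move=> d0; have dz : d%:Z != 0 by rewrite eqz_nat -lt0n.
exists `|(p %% d)%Z|%N, (p %/ d)%Z.
have h0 := modz_ge0 p dz; have h1 : (p %% d)%Z < d by rewrite ltz_pmod.
split; first lia.
by rewrite gez0_abs// mulrC addrC -divz_eq.
Qed.

Lemma extend_winding (n : nat) (L : R) (f : nat -> R) : (0 < n)%N ->
  (forall i, (i.+1 < n)%N -> f i <= f i.+1) -> f n.-1 <= f 0%N + L ->
  exists t, [/\ nondec t, winds n L t & forall i, (i < n)%N -> t i%:Z = f i].
Proof.
move=> n0 fS fn.
have nz : n%:Z != 0 by rewrite eqz_nat -lt0n.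
pose t (i : int) := f `|(i %% n)%Z|%N + L * (i %/ n)%Z%:~R.
have tE (r : nat) (q : int) : (r < n)%N -> t (r%:Z + n%:Z * q) = f r + L * q%:~R.
  move=> rn; rewrite (_ : r%:Z + _ = q * n%:Z + r%:Z); last by ring.
  rewrite /t modzMDl divzMDl//.
  by rewrite modz_small ?divz_small//= ?addr0//; lia.
have split_int i := int_euclid i n0.
exists t; split.
- suff S i : t i <= t (i + 1).
    have pos (m : nat) i : t i <= t (i + m%:Z).
      elim: m => [|m IH]; first by rewrite addr0.
      by apply: le_trans IH _; rewrite intS addrCA addrC; exact: S.
    by move=> i j ij; have := pos `|j - i|%N i; rewrite gez0_abs ?subr_ge0// addrCA subrr addr0.
  have [r [q [rn ->]]] := split_int i.
  have [rn1|] := ltnP r.+1 n.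
    rewrite addrAC -[1%R]/(Posz 1) -PoszD addn1 !tE// lerD2r; exact: fS.
  move=> nr; have rE : r = n.-1 by lia.
  have -> : r%:Z + n%:Z * q + 1 = 0%N%:Z + n%:Z * (q + 1).
    by rewrite mulrDr mulr1 rE; lia.
  by rewrite !tE// rE intrD mulrDr mulr1 addrA (addrAC _ _ L) lerD2r.
- move=> i; have [r [q [rn ->]]] := split_int i.
  rewrite -addrA -{2}[n%:Z]mulr1 -mulrDr !tE// intrD mulrDr mulr1; lra.
- by move=> i i_n; have := tE i 0 i_n; rewrite !mulr0 !addr0.
Qed.

(* If [u_i <= v_j <= v_(j+1) <= u_(i+1)], splice one period of [u] starting at
   [u_(i+1)] and one period of [v] starting at [v_(j+1)] into a sequence [z] with
   [2 n] terms winding twice; [z] and its translate by half a period interlace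
   everywhere, and their maximum and minimum wind once with [n] terms each. *)
Lemma splice (n : nat) (L : R) u v : (0 < n)%N -> 0 < L ->
  nondec u -> nondec v -> winds n L u -> winds n.+2 L v ->
  exists x y, [/\ nondec x /\ winds n.+1 L x, nondec y /\ winds n.+1 L y,
   forall I, is_interval I -> hits I u -> hits I v -> hits I x /\ hits I y &
   forall w, w = u \/ w = v -> forall i, exists j k, w i = x j + L * k%:~R \/
                                                    w i = y j + L * k%:~R].
Proof.
move=> n0 L0 nu nv un vn.
have [i [j [uv vu]]] := crossing n0 L0 nu nv un vn.
(* The block [u (i + 1), ..., u (i + n)] is followed by [v (j + 1), ..., v (j + n + 2)] raised by
   [L]: in all [2 * (n + 1)] terms for two turns. The crossing makes both seams nondecreasing. *)
pose f r := if (r < n)%N then u (i + 1 + r%:Z) else v (j + 1 + r%:Z - n%:Z) + L.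
have fu r : (r < n)%N -> f r = u (i + 1 + r%:Z) by rewrite /f => ->.
have fv r : (n <= r)%N -> f r = v (j + 1 + r%:Z - n%:Z) + L.
  by rewrite /f ltnNge => ->.
have vjj : v j <= v (j + 1) by apply: nv; rewrite lerDl.
have f0 : f 0%N = u (i + 1) by rewrite fu// addr0.
have fn1 : f n.-1 = u i + L.
  by rewrite fu ?prednK// -un; congr u; lia.
have fn : f n = v (j + 1) + L by rewrite fv// addrK.
have fl : f (n + n.+1)%N = v j + L + L.
  by rewrite fv ?leq_addr// -(vn j); congr (v _ + _); lia.
have [z [nz zn zf]] : exists z, [/\ nondec z, winds (n.+1 + n.+1) (L + L) z &
    forall r, (r < n.+1 + n.+1)%N -> z r%:Z = f r].
  apply: extend_winding => // [r rn|].
    have [r1|r1|r1] := ltngtP r n.-1.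
    - by rewrite !fu; [apply: nu; lia|lia|lia].
    - by rewrite !fv; [rewrite lerD2r; apply: nv; lia|lia|lia].
    - rewrite r1 prednK// fn1 fn lerD2r; exact: le_trans vjj.
  rewrite addSn/= fl f0 -addrA lerD2r; exact: le_trans vu.
(* Advancing by [n + 1] exchanges [z] and [T] up to the increment [L], so their maximum and minimum
   wind once with [n + 1] terms. *)
pose T (k : int) := z (k + n.+1%:Z) - L.
have nT : nondec T by move=> a b ab; rewrite lerD2r; apply: nz; rewrite lerD2r.
have zT k : z (k + n.+1%:Z) = T k + L by rewrite subrK.
have Tz k : T (k + n.+1%:Z) = z k + L.
  by rewrite /T -addrA -PoszD zn addrA addrK.
exists (fun k => Num.max (z k) (T k)), (fun k => Num.min (z k) (T k)); split.
- split; first exact: nondec_max.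
  by move=> k; rewrite zT Tz addr_maxl maxC.
- split; first exact: nondec_min.
  by move=> k; rewrite zT Tz addr_minl minC.
- move=> I II [p up] [p' vp].
  suff [hz hT] : hits I z /\ hits I T by exact: hits_maxmin.
  (* A value [f r + L * q] is a term of [z] for even [q] and of [T] for odd [q]. *)
  have par (c : R) (r : nat) (q : int) : (r < n.+1 + n.+1)%N -> I c ->
      c = f r + L * q%:~R -> if (q %% 2)%Z == 0 then hits I z else hits I T.
    move=> rn Ic cE.
    case: eqP => q2.
      exists (r%:Z + (n.+1 + n.+1)%N%:Z * (q %/ 2)%Z).
      rewrite (windsM _ _ zn) zf// (_ : _ + _ = c)// cE.
      by rewrite [in RHS](divz_eq q 2) q2 addr0 intrM; ring.
    exists (r%:Z + (n.+1 + n.+1)%N%:Z * ((q %/ 2)%Z + 1) - n.+1%:Z).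
    rewrite /T subrK (windsM _ _ zn) zf// (_ : _ + _ - L = c)// cE.
    have : q = (q %/ 2)%Z * 2 + 1 by rewrite {1}(divz_eq q 2); lia.
    set k := (q %/ 2)%Z => ->.
    by rewrite !intrD intrM; ring.
  have [r [q [rn pE]]] := int_euclid (p - (i + 1)) n0.
  have {}pE : u p = f r + L * q%:~R.
    by rewrite fu// -(windsM _ _ un); congr u; lia.
  have [s [q' [sn p'E]]] := int_euclid (p' - (j + 1)) (ltn0Sn n.+1).
  have {}p'E : v p' = f (n + s)%N + L * (q' - 1)%:~R.
    rewrite fv ?leq_addr// (_ : j + 1 + _ - _ = j + 1 + s%:Z); last lia.
    rewrite (_ : _ + L + _ = v (j + 1 + s%:Z) + L * q'%:~R).
      by rewrite -(windsM _ _ vn); congr v; lia.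
    by rewrite intrD intrN; ring.
  move: (q' - 1) p'E => q1 p'E.
  have z_r : f 0%N <= f r <= f n.-1.
    by rewrite -!zf; [apply/andP; split; apply: nz; lia|lia|lia|lia].
  have z_s : f n <= f (n + s)%N <= f (n + n.+1)%N.
    by rewrite -!zf; [apply/andP; split; apply: nz; lia|lia|lia|lia].
  have par1 := par _ r q _ up pE.
  have par2 := par _ (n + s)%N q1 _ vp p'E.
  have {}par1 : if (q %% 2)%Z == 0 then hits I z else hits I T by apply: par1; lia.
  have {}par2 : if (q1 %% 2)%Z == 0 then hits I z else hits I T by apply: par2; lia.
  have [qq1|qq1] := eqVneq (q %% 2)%Z (q1 %% 2)%Z; last first.
    move: par1 par2; case: eqP => m1; case: eqP => m2 // _ _.
    - by move: qq1; rewrite m1 m2.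
    - by exfalso; lia.
  rewrite f0 fn1 in z_r; rewrite fn fl in z_s.
  move/andP: z_r => [r1 r2]; move/andP: z_s => [s1 s2].
  (* If the parities agree, a term of the other parity is sought between [u p] and [v p']: the end
     of a [v] block when [q <= q1], the beginning of one otherwise. *)
  suff [c [m [Ic cE mq]]] : exists c m, [/\ I c,
      c = f (n + n.+1)%N + L * m%:~R \/ c = f n + L * m%:~R & (m %% 2)%Z != (q %% 2)%Z].
    have : if (m %% 2)%Z == 0 then hits I z else hits I T.
      by case: cE => cE; [apply: (par c (n + n.+1)%N)|apply: (par c n)] => //; lia.
    move: par1; case: eqP => m1; case: eqP => m2 // _ _.
    - by move: mq; rewrite m1 m2.
    - by exfalso; lia.
  have [qle|qgt] := leP q q1.
    exists (f (n + n.+1)%N + L * (q - 1)%:~R), (q - 1); split; [|by left|lia].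
    apply: (II _ _ up vp).
    have : L * q%:~R <= L * q1%:~R by rewrite ler_pM2l// ler_int.
    rewrite pE p'E fl intrD intrN mulrDr mulrN mulr1.
    move: (L * q%:~R) (L * q1%:~R) => A B AB.
    by apply/andP; split; lra.
  have qgt2 : q1 + 2 <= q by lia.
  exists (f n + L * (q1 + 1)%:~R), (q1 + 1); split; [|by right|lia].
  apply: (II _ _ vp up).
  have : L * q1%:~R + 2 * L <= L * q%:~R.
    have -> : L * q1%:~R + 2 * L = L * (q1 + 2)%:~R by rewrite intrD; ring.
    by rewrite ler_pM2l// ler_int.
  rewrite pE p'E fn intrD mulrDr mulr1.
  move: (L * q%:~R) (L * q1%:~R) => A B AB.
  by apply/andP; split; lra.
- move=> w wE p.
  have [r [q [rn ->]]] : exists r q, (r < n.+1 + n.+1)%N /\ w p = f r + L * q%:~R.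
    case: wE => ->.
      have [r [q [rn pE]]] := int_euclid (p - (i + 1)) n0.
      exists r, q; split; first lia.
      by rewrite fu// -(windsM _ _ un); congr u; lia.
    have [s [q [sn pE]]] := int_euclid (p - (j + 1)) (ltn0Sn n.+1).
    exists (n + s)%N, (q - 1); split; first lia.
    rewrite fv ?leq_addr// (_ : j + 1 + _ - _ = j + 1 + s%:Z); last lia.
    rewrite (_ : _ + L + _ = v (j + 1 + s%:Z) + L * q%:~R).
      by rewrite -(windsM _ _ vn); congr v; lia.
    by rewrite intrD intrN; ring.
  (* Each term of [z] is the maximum or the minimum at its index. *)
  exists r%:Z, q; rewrite -zf//.
  have [zT'|Tz'] := leP (z r%:Z) (T r%:Z); first by right.
  by left.
Qed.

End Sequences.

(** * Submodularity of the truncated area and symmetric minimizers *)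

Section WindingCells.
Variable R : realType.
Variable N : R * R -> R.
Hypothesis NP : is_plane_norm N.
Variable r : R.

Let plane := (measurableTypeR R * measurableTypeR R)%type.
Notation vertex := (vertex N).

Definition seq_cell (t : int -> R) : set (R * R) :=
  cell N (range (fun i => vertex (t i))).

Definition seq_area (t : int -> R) := area (seq_cell t `&` disk N r).

Lemma seq_area_lty (t : int -> R) : (seq_area t < +oo)%E.
Proof.
by apply: (disk_subset_lty NP (cell_disk_measurable NP _ r) (r := r)) => z [].
Qed.

Lemma seq_cellP (t : int -> R) (y : R * R) :
  seq_cell t y <-> forall i, N y <= N (y - vertex (t i)).
Proof.
split=> [h i|h _ [i _ <-]]; last exact: h.
by apply: h; exists i.
Qed.

Lemma seq_cellPn (t : int -> R) (y : R * R) :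
  ~ seq_cell t y <-> exists i, N (y - vertex (t i)) < N y.
Proof.
split=> [h|[i yi] /seq_cellP/(_ i)]; last by rewrite leNgt yi.
apply: contrapT => H; apply/h/seq_cellP => i; rewrite leNgt; apply/negP => yi.
by apply: H; exists i.
Qed.

(** A point in both cells of [x] and [y] is cut by no term of [u] or [v], since up to turns these
    are terms of [x] or [y]. A point in neither cell of [u] and [v] has its interval of cutting
    directions hit by both, hence by [x] and [y], so it is in neither of their cells. Then
    [area_modular] applies. *)
Lemma seq_area_exchange (m n : nat) (u v x y : int -> R) :
  winds m (2 * pi) u -> winds n (2 * pi) v ->
  (forall I, is_interval I -> hits I u -> hits I v -> hits I x /\ hits I y) ->
  (forall w, w = u \/ w = v -> forall i, exists j k,
     w i = x j + turn R k \/ w i = y j + turn R k) ->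
  (seq_area x + seq_area y <= seq_area u + seq_area v)%E.
Proof.
move=> um vn hxy cov.
have mC t := cell_disk_measurable NP (range (fun i => vertex (t i))) r.
apply: area_modular; [exact: mC|exact: mC|exact: mC|exact: mC
  |exact: seq_area_lty|exact: seq_area_lty| |].
- move=> z [[zx zr] [zy _]].
  have H w : w = u \/ w = v -> seq_cell w z.
    move=> wE; apply/seq_cellP => i.
    have [j [k [->|->]]] := cov w wE i; rewrite vertex_turn.
      exact: (seq_cellP _ _).1 zx j.
    exact: (seq_cellP _ _).1 zy j.
  by split; split => //; apply: H; [left|right].
- move=> z zxy; have zr : disk N r z by case: zxy => -[].
  apply: contrapT => H.
  have [I II IP] := cut_arc NP z.
  (* Full turns are absorbed by moving the index a whole number of periods. *)
  have hit n' w : winds n' (2 * pi) w -> ~ seq_cell w z -> hits I w.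
    move=> wn /seq_cellPn[i /IP[k Ik]]; exists (i + n'%:Z * k).
    by rewrite (windsM _ _ wn).
  have nhit w : hits I w -> ~ seq_cell w z.
    move=> [i Ii]; apply/seq_cellPn; exists i; apply/IP; exists 0.
    by rewrite /turn mulr0 addr0.
  have hu : hits I u by apply: hit um _ => zu; apply: H; left.
  have hv : hits I v by apply: hit vn _ => zv; apply: H; right.
  have [hx hy] := hxy I II hu hv.
  by case: zxy => -[zc _]; [exact: nhit hx zc|exact: nhit hy zc].
Qed.

(** The directions in [[0, 2 * pi)] are sorted and extended periodically. *)
Lemma winding_of_points (n : nat) (p : 'I_n -> R * R) : (0 < n)%N ->
  (forall i, N (p i) = 2) ->
  exists t, [/\ nondec t, winds n (2 * pi) t & seq_cell t = cell N (range p)].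
Proof.
move=> n0 p2.
have [a aP] : {a : 'I_n -> R & forall i, 0 <= a i < 2 * pi /\ p i = vertex (a i)}.
  by apply: (@choice _ _ (fun i b => 0 <= b < 2 * pi /\ p i = vertex b)) => i; exact: vertex_surj.
pose s := sort <=%R [seq a i | i <- enum 'I_n].
have ss : size s = n by rewrite size_sort size_map size_enum_ord.
have sP b : b \in s <-> exists i, b = a i.
  rewrite mem_sort; split=> [/mapP[i _ ->]|[i ->]]; first by exists i.
  by apply: map_f; rewrite mem_enum.
have sle i j : (i <= j)%N -> (j < n)%N -> nth 0 s i <= nth 0 s j.
  move=> ij jn; apply: (sorted_leq_nth le_trans le_refl); rewrite ?inE ?ss//.
    by apply: sort_sorted; exact: le_total.
  exact: leq_ltn_trans jn.
have sb i : (i < n)%N -> 0 <= nth 0 s i < 2 * pi.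
  by move=> i_n; have /sP[j ->] := mem_nth 0 (s := s) (n := i) ltac:(by rewrite ss); case: (aP j).
have [t [nt tn tf]] : exists t, [/\ nondec t, winds n (2 * pi) t &
    forall i, (i < n)%N -> t i%:Z = nth 0 s i].
  apply: extend_winding => // [i i_n|]; first by apply: sle.
  have /andP[h0 _] := sb 0%N n0; have /andP[_ h1] := sb n.-1 ltac:(by rewrite ltn_predL).
  by rewrite (le_trans (ltW h1))// lerDr.
exists t; split => //; congr (cell N _); apply/seteqP; split => _ [i _ <-].
  have [k [q [kn ->]]] := int_euclid i n0.
  rewrite (windsM _ _ tn) -/(turn R q) vertex_turn tf//.
  have /sP[j ->] := mem_nth 0 (s := s) (n := k) ltac:(by rewrite ss).
  by exists j => //; case: (aP j).
have : a i \in s by apply/sP; exists i.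
move=> ais; exists (index (a i) s)%:Z => //.
by rewrite tf ?nth_index ?(aP i).2// -[X in (_ < X)%N]ss index_mem.
Qed.

Lemma points_of_winding (n : nat) (t : int -> R) : (0 < n)%N ->
  winds n (2 * pi) t -> exists p : 'I_n -> R * R,
  (forall i, N (p i) = 2) /\ seq_cell t = cell N (range p).
Proof.
move=> n0 tn; exists (fun i => vertex (t i%:Z)); split.
  by move=> i; exact: norm_vertex.
congr (cell N _); apply/seteqP; split => _ [i _ <-]; last by exists i%:Z.
have [k [q [kn ->]]] := int_euclid i n0.
by exists (Ordinal kn) => //=; rewrite (windsM _ _ tn) -/(turn R q) vertex_turn.
Qed.

(** The competitors are all families of points of norm at least 2, so that the minimum is the
    infimum over all B-n-gons. *)
Definition min_winding (n : nat) (t : int -> R) := [/\ nondec t, winds n (2 * pi) t &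
  forall p : 'I_n -> R * R, (forall i, 2 <= N (p i)) ->
    (seq_area t <= area (cell N (range p) `&` disk N r))%E].

Lemma min_winding_le (n : nat) (t u : int -> R) : (0 < n)%N ->
  min_winding n t -> winds n (2 * pi) u -> (seq_area t <= seq_area u)%E.
Proof.
move=> n0 [_ _ tmin] un; have [p [p2 uE]] := points_of_winding n0 un.
by rewrite [leRHS]/seq_area uE; apply: tmin => i; rewrite p2.
Qed.

Lemma min_winding_eq (n : nat) (t u : int -> R) :
  min_winding n t -> nondec u -> winds n (2 * pi) u -> seq_area u = seq_area t ->
  min_winding n u.
Proof.
move=> [_ _ tmin] nu un ut; split; [exact: nu|exact: un|].
by rewrite ut; exact: tmin.
Qed.

Lemma min_winding_exists (n : nat) : (0 < n)%N -> exists t, min_winding n t.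
Proof.
move=> n0; have [p [p2 pmin]] := area_cell_min NP n r.
have [t [nt tn tE]] := winding_of_points n0 p2.
by exists t; split; [exact: nt|exact: tn|rewrite /seq_area tE; exact: pmin].
Qed.

(** The areas of the maximum and the minimum add up to at most twice the least area, and neither is
    below it; finiteness permits the cancellation. *)
Lemma min_winding_max (n : nat) (t u : int -> R) : (0 < n)%N ->
  min_winding n t -> min_winding n u ->
  min_winding n (fun i => Num.max (t i) (u i)).
Proof.
move=> n0 mt mu; have [nt tn tmin] := mt; have [nu un umin] := mu.
have wM := winds_max tn un; have wm := winds_min tn un.
have ut : seq_area u = seq_area t.
  by apply/le_anti/andP; split; [exact: min_winding_le mu tn|exact: min_winding_le mt un].
have cov w : w = t \/ w = u -> forall i, exists j k,
    w i = Num.max (t j) (u j) + turn R k \/ w i = Num.min (t j) (u j) + turn R k.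
  move=> wE i; exists i, 0; rewrite /turn mulr0 !addr0.
  by case: wE => ->; case: (leP (t i) (u i)) => _; [right|left|left|right].
have := seq_area_exchange tn un (fun I II => hits_maxmin II nt nu) cov.
rewrite ut => ex.
apply: (min_winding_eq mt _ wM); first exact: nondec_max.
apply/le_anti/andP; split; last exact: min_winding_le n0 mt wM.
have fm : seq_area (fun i => Num.min (t i) (u i)) \is a fin_num.
  by rewrite ge0_fin_numE ?seq_area_lty//; exact: measure_ge0.
rewrite -(leeD2rE _ _ fm); apply: le_trans ex _; apply: leeD2l.
exact: min_winding_le n0 mt wm.
Qed.

Lemma seq_cell_shift (t : int -> R) (a : R) (c : int) :
  (forall z, N (rotation a z) = N z) ->
  seq_cell (fun i => t (i + c) - a) = rotation a @^-1` seq_cell t.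
Proof.
move=> Na; have vE b : vertex b = rotation a (vertex (b - a)).
  rewrite /vertex rotationZ rotation_circle -(Na (circle (b - a))).
  by rewrite rotation_circle addrC subrK.
apply/seteqP; split => y /=.
  move=> /seq_cellP h; apply/seq_cellP => i.
  by rewrite vE -rotationB !Na; have := h (i - c); rewrite subrK.
move=> /seq_cellP h; apply/seq_cellP => i.
by have := h (i + c); rewrite vE -rotationB !Na.
Qed.

Lemma seq_area_shift (t : int -> R) (a : R) (c : int) :
  (forall z, N (rotation a z) = N z) -> 0 <= a <= 2 * pi ->
  seq_area (fun i => t (i + c) - a) = seq_area t.
Proof.
move=> Na a02; rewrite /seq_area (seq_cell_shift _ _ Na).
rewrite -[RHS](area_rotation a02); last exact: cell_disk_measurable.
by congr area; apply/seteqP; split => z; rewrite /disk/= Na.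
Qed.

Lemma min_winding_symmetric (n k : nat) : (0 < n)%N -> (0 < k)%N -> (k %| n)%N ->
  (forall z, N (rotation (2 * pi / k%:R) z) = N z) ->
  exists t, min_winding n t /\
    forall y, seq_cell t (rotation (2 * pi / k%:R) y) <-> seq_cell t y.
Proof.
move=> n0 k0 /dvdnP[m nE]; set a := 2 * pi / k%:R => Na.
have [t mt] := min_winding_exists n0; have [nt tn _] := mt.
have kr : 0 < k%:R :> R by rewrite ltr0n.
have a0 : 0 <= a by rewrite divr_ge0// mulr_ge0// pi_ge0.
have ak : a * k%:R = 2 * pi by rewrite divfK// gt_eqF.
have Nal (l : nat) z : N (rotation (a * l%:R) z) = N z.
  elim: l z => [|l IH] z; first by rewrite mulr0 rotation0.
  by rewrite -natr1 mulrDr mulr1 rotationD IH Na.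
(* Each rotation by [a] is paired with an index shift by [m = n / k], so that after [k] of them the
   winding gives back [t] exactly. *)
pose T (l : nat) (i : int) := t (i + (m * l)%N%:Z) - a * l%:R.
have mT l : (l < k)%N -> min_winding n (T l).
  move=> lk; apply: (min_winding_eq mt).
  - by move=> i j ij; rewrite lerD2r nt// lerD2r.
  - by move=> i; rewrite /T addrAC tn addrAC.
  - apply: seq_area_shift => //; rewrite mulr_ge0//= -ak ler_wpM2l// ler_nat.
    exact: ltnW.
have Tk i : T k i = t i by rewrite /T -nE tn ak addrK.
have TS l i : T l (i + m%:Z) - a = T l.+1 i.
  rewrite /T -natr1 mulrDr mulr1 opprD addrA mulnS PoszD.
  by rewrite [i + _ + _]addrAC addrA [i + _ + _]addrAC.
(* [w l] is the maximum of [T 0, ..., T l]. *)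
pose w := fix w (l : nat) (i : int) {struct l} : R :=
  if l is l'.+1 then Num.max (w l' i) (T l i) else t i.
have T0 i : T 0%N i = t i by rewrite /T muln0 mulr0 addr0 subr0.
have w_ge l j i : (j <= l)%N -> T j i <= w l i.
  elim: l => [|l IH]; first by rewrite leqn0 => /eqP->; rewrite T0.
  rewrite leq_eqVlt ltnS => /predU1P[->|/IH h]; rewrite /= le_max ?lexx ?orbT//.
  by rewrite h.
have w_ex l i : exists2 j, (j <= l)%N & w l i = T j i.
  elim: l => [|l [j jl wE]]; first by exists 0%N => //; rewrite T0.
  rewrite /=; case: (leP (w l i) (T l.+1 i)) => _; first by exists l.+1.
  by exists j => //; exact: leqW.
have mw l : (l < k)%N -> min_winding n (w l).
  elim: l => [|l IH] lk; first exact: mt.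
  exact: min_winding_max n0 (IH (ltnW lk)) (mT _ lk).
exists (w k.-1); split; first by apply: mw; rewrite ltn_predL.
(* This operation sends [T l] to [T l.+1] and [T k] equals [T 0], so it permutes the copies
   cyclically and fixes their maximum. *)
have wT : (fun i => w k.-1 (i + m%:Z) - a) = w k.-1.
  apply/funext => i; apply/eqP; rewrite eq_le; apply/andP; split.
    have [j jk ->] := w_ex k.-1 (i + m%:Z); rewrite TS.
    have [jk1|] := ltnP j k.-1; first exact: w_ge.
    move=> kj; have -> : j.+1 = k by lia.
    by rewrite Tk -T0; exact: w_ge.
  have [[|j] jk ->] := w_ex k.-1 i.
    rewrite T0 -Tk -(prednK k0) -TS lerD2r; exact: w_ge.
  by rewrite -TS lerD2r; apply: w_ge; exact: ltnW.
by move=> y; rewrite -[in X in _ <-> X]wT (seq_cell_shift _ _ Na).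
Qed.

End WindingCells.

(** * From winding sequences back to B-n-gons *)

Section Bgons.
Variable R : realType.
Variable M : set (R * R).
Hypothesis M_body : o_symmetric_convex_body M.
Hypothesis M_strict : strictly_convex M.
Variable lambda : R.
Hypothesis lambda_gt0 : 0 < lambda.

Let N := gauge_norm M.
Let NP : is_plane_norm N := gauge_is_plane_norm M_body M_strict.

Let dilate_disk : dilate (1 + lambda) M = disk N (1 + lambda).
Proof. by rewrite (dilate_gauge_norm M_body) ?addr_gt0. Qed.

Let cell_set (n : nat) (x : 'I_n -> R * R) :
  [set y | forall i, N y <= N (y - x i)] = cell N (range x).
Proof.
by apply/seteqP; split => y /= h; [move=> _ [i _ <-]|move=> i; apply: h; exists i].
Qed.

Lemma Bgon_seq_cell (n : nat) (t : int -> R) : (0 < n)%N ->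
  winds n (2 * pi) t -> Bgon M n (seq_cell N t).
Proof.
move=> n0 tn; have [p [p2 ->]] := points_of_winding NP n0 tn.
by exists p; split=> [i|]; [have -> : gauge_norm M (p i) = 2 := p2 i|rewrite cell_set].
Qed.

Lemma truncated_area_seq_cell (t : int -> R) :
  truncated_area M lambda (seq_cell N t) = seq_area N (1 + lambda) t.
Proof. by rewrite /truncated_area dilate_disk. Qed.

Lemma inf_truncated_areaE (n : nat) (t : int -> R) : (0 < n)%N ->
  min_winding N (1 + lambda) n t ->
  inf_truncated_area M lambda n = seq_area N (1 + lambda) t.
Proof.
move=> n0 [_ tn tmin]; apply/eqP; rewrite eq_le; apply/andP; split.
  apply: ereal_inf_lbound; exists (seq_cell N t); first exact: Bgon_seq_cell.
  exact: truncated_area_seq_cell.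
apply: le_ereal_inf_tmp => _ [P [x [x2 ->]] <-].
by rewrite /truncated_area dilate_disk cell_set; exact: tmin.
Qed.

(** Splicing minimizers with [n] and [n + 2] terms yields two competitors with [n + 1] terms and no
    larger total area. *)
Lemma inf_truncated_area_convex (n : nat) : (0 < n)%N ->
  (2%:E * inf_truncated_area M lambda n.+1 <=
   inf_truncated_area M lambda n + inf_truncated_area M lambda n.+2)%E.
Proof.
move=> n0.
have [u mu] := min_winding_exists NP (1 + lambda) n0.
have [v mv] := min_winding_exists NP (1 + lambda) (ltn0Sn n.+1).
have [w mw] := min_winding_exists NP (1 + lambda) (ltn0Sn n).
rewrite (inf_truncated_areaE _ mu)// (inf_truncated_areaE _ mv)//.
rewrite (inf_truncated_areaE _ mw)//.
have [nu un _] := mu; have [nv vn _] := mv.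
have pi2 : 0 < 2 * pi :> R by rewrite mulr_gt0// pi_gt0.
have [x [y [[nx xn] [ny yn] hxy cov]]] := splice n0 pi2 nu nv un vn.
apply: le_trans (seq_area_exchange NP (1 + lambda) un vn hxy cov).
by rewrite mule_natl mule2n; apply: leeD; exact: min_winding_le mw _.
Qed.

Lemma gauge_norm_rotation (k : nat) : rotational_symmetry k M ->
  forall z, N (rotation (2 * pi / k%:R) z) = N z.
Proof.
rewrite /rotational_symmetry; set a := 2 * pi / k%:R => Mk.
have Ma z : M (rotation a z) <-> M z.
  split=> [|Mz]; last by rewrite -Mk; exists z.
  by rewrite -{1}Mk => -[x Mx /(can_inj (rotationK a)) <-].
have Na z c : 0 < c -> N (rotation a z) <= c <-> N z <= c.
  by move=> c0; rewrite !(gauge_norm_leP M_body)// -rotationZ.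
have r0 b : rotation b 0 = 0 :> R * R by have := rotationZ b 0 0; rewrite !scale0r.
have a0 z : z != 0 -> rotation a z != 0.
  by apply: contra => /eqP az; rewrite -(rotationK a z) az r0.
move=> z; have [->|z0] := eqVneq z 0; first by rewrite r0.
apply/eqP; rewrite eq_le; apply/andP; split.
  by apply/Na => //; exact: plane_norm_gt0.
apply/(Na z _ _).1 => //; apply: (plane_norm_gt0 NP); exact: a0.
Qed.

Lemma symmetric_minimal_Bgon (n k : nat) : (0 < n)%N -> (0 < k)%N ->
  (k %| n)%N -> rotational_symmetry k M ->
  exists P : set (R * R), [/\ Bgon M n P, rotational_symmetry k P &
    truncated_area M lambda P = inf_truncated_area M lambda n].
Proof.
move=> n0 k0 kn /gauge_norm_rotation Na.
have [t [mt tsym]] := min_winding_symmetric NP (1 + lambda) n0 k0 kn Na.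
have [_ tn _] := mt.
exists (seq_cell N t); split; first exact: Bgon_seq_cell.
  apply/seteqP; split => [_ [x xt <-]|y yt]; first exact/tsym.
  exists (rotation (- (2 * pi / k%:R)) y); last by rewrite rotationNK.
  by apply/tsym; rewrite rotationNK.
by rewrite truncated_area_seq_cell (inf_truncated_areaE n0 mt).
Qed.

Lemma rotational_symmetry2 (S : set (R * R)) :
  rotational_symmetry 2 S <-> o_symmetric S.
Proof.
rewrite /rotational_symmetry /o_symmetric.
have -> : rotation (2 * pi / 2%:R) = (-%R : R * R -> R * R).
  have -> : 2 * pi / 2%:R = pi :> R by field.
  by apply/funext => -[x y]; rewrite /rotation cospi sinpi; congr pair => /=; ring.
by [].
Qed.

End Bgons.

Unset Implicit Arguments.
Set Strict Implicit.

Theorem theorem1p9 (R : realType) (M : set (R * R))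
  (M_body : o_symmetric_convex_body M)
  (M_strict : strictly_convex M)
  (M_smooth : Cinfty_boundary M)
  (lambda : R) (lambda_gt0 : 0 < lambda) :
  [/\ forall n : nat, (4 <= n)%N ->
        (2%:E * inf_truncated_area M lambda n <=
         inf_truncated_area M lambda n.-1 + inf_truncated_area M lambda n.+1)%E,
      forall n k : nat, (3 <= n)%N -> (0 < k)%N -> (k %| n)%N ->
        rotational_symmetry k M ->
        exists P : set (R * R),
          [/\ Bgon M n P, rotational_symmetry k P &
              truncated_area M lambda P = inf_truncated_area M lambda n]
    & forall n : nat, (3 <= n)%N -> ~~ odd n ->
        exists P : set (R * R),
          [/\ Bgon M n P, o_symmetric P &
              truncated_area M lambda P = inf_truncated_area M lambda n] ].
Proof.
split.
- case=> [//|n] n3; apply: inf_truncated_area_convex => //; lia.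
- move=> n k n3; apply: symmetric_minimal_Bgon => //; lia.
- move=> n n3 n_even.
  (* Symmetry about the origin is 2-fold rotational symmetry, which [M] has as an o-symmetric
     body. *)
  have [||||P [PB Psym PE]] := symmetric_minimal_Bgon M_body M_strict lambda_gt0 (n := n) (k := 2).
  + lia.
  + by [].
  + by rewrite dvdn2.
  + by apply/rotational_symmetry2; case: M_body.
  by exists P; split => //; exact/rotational_symmetry2.
Qed.
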